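(* Let $p>1$, $V=H^1(\mathbb{R},\mathbb{C})$ and $\widetilde V=V\times\mathbb{R}$. A smooth curve $\gamma:[a,b]\to\widetilde V$, $\gamma(s)=(u(s),t(s))$, is critical for the action $\mathcal{S}_\gamma=\int_\gamma\alpha$ if and only if $\dot\gamma(s)\in\ker\widetilde\omega_{\gamma(s)}$ for all $s$. In other words, $$\delta\mathcal{S}_\gamma=0\iff\dot\gamma(s)\in\ker\widetilde\omega_{\gamma(s)}\ \text{ for all } s\in[a,b].$$
   Context: $V=H^1(\mathbb{R},\mathbb{C})$ is viewed as a real Hilbert space, with $\omega(u,v)=\mathrm{Im}\int u\bar v\,dx$. The Hamiltonian is $H:V\to\mathbb{R}$, $H(u)=\int\left(\tfrac14|\partial_xu|^2-\tfrac1{p+1}|u|^{p+1}\right)dx$, with differential $dH_u(v)=\frac{d}{ds}\big|_{s=0}H(u+sv)$. On $\widetilde V=V\times\mathbb{R}$, with $T_{(u,t)}\widetilde V$ identified with $V\times\mathbb{R}$, the one-form $\alpha$ is $$\alpha_{(u,t)}(v,T)=\tfrac12\omega(u,v)-H(u)T,$$ and $\widetilde\omega=d\alpha$, that is, $$\widetilde\omega_{(u,t)}((v_1,T_1),(v_2,T_2))=\omega(v_1,v_2)-dH_u(v_1)T_2+dH_u(v_2)T_1 .$$ Its kernel is $$\ker\widetilde\omega_{(u,t)}=\{(v,T)\in T_{(u,t)}\widetilde V:\ \widetilde\omega_{(u,t)}((v,T),(v',T'))=0\ \ \forall (v',T')\in T_{(u,t)}\widetilde V\}.$$ The action of a curve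 $\gamma$ is $\mathcal{S}_\gamma=\int_\gamma\alpha=\int_a^b\alpha_{\gamma(s)}(\dot\gamma(s))\,ds$. The curve $\gamma$ is critical for $\mathcal{S}$ (written $\delta\mathcal{S}_\gamma=0$) if for every smooth family of curves $\gamma_r:[a,b]\to\widetilde V$, $|r|<\varepsilon$ (smooth in $(r,s)$), with $\gamma_0=\gamma$ and with $\gamma_r(s)=\gamma(s)$ for all $r$ and all $s$ outside some compact subset of $(a,b)$, one has $\frac{d}{dr}\mathcal{S}_{\gamma_r}\big|_{r=0}=0$. *)

(* Defs.v *)
From HB Require Import structures.
From mathcomp Require Import all_boot all_order all_algebra.
From mathcomp Require Import ring_quotient generic_quotient.
From mathcomp Require Import all_classical all_reals all_analysis.
From mathcomp Require Import measurable_realfun complex.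
From mathcomp Require Import ring lra.
Set Implicit Arguments.
Unset Strict Implicit.
Unset Printing Implicit Defensive.
Import Order.TTheory GRing.Theory Num.Theory.
Import numFieldNormedType.Exports.
Local Open Scope classical_set_scope.
Local Open Scope ring_scope.
Local Open Scope quotient_scope.
Section SobolevGraph.
Context {R : realType}.
Local Notation mu := (@lebesgue_measure R).
Local Notation C := (Rcomplex R).

(* [Rcomplex R] is [R[i]] seen as a vector space over [R], with [R]-valued
   modulus. *)
Definition cintegral (f : R -> C) : C :=
  Complex (\int[mu]_x complex.Re (f x)) (\int[mu]_x complex.Im (f x)).

Definition square_integrable (f : R -> C) : Prop :=
  (fun x => complex.Re (f x)) \in Lfun mu 2%:E /\
  (fun x => complex.Im (f x)) \in Lfun mu 2%:E.

Definition test_function (phi : R -> R) : Prop :=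
  (forall n x, derivable (derive1n n phi) x 1) /\
  compact (closure [set x | phi x != 0]).

(* Real test functions suffice: both sides are complex-linear in [phi]. *)
Definition weak_derivative (u g : R -> C) : Prop :=
  forall phi, test_function phi ->
    cintegral (fun x => derive1 phi x *: u x) =
    - cintegral (fun x => phi x *: g x).

Definition sobolev_graph : {pred (R -> C) * (R -> C)} :=
  [pred z | `[< [/\ square_integrable z.1, square_integrable z.2 &
                    weak_derivative z.1 z.2] >] ].

Let Lfun2_submod : submod_closed (Lfun mu 2%:E).
Proof. exact: (Lfun_submod_closed mu (lee1n 2)). Qed.

Lemma square_integrable_lin (a : R) (f g : R -> C) :
  square_integrable f -> square_integrable g -> square_integrable (a *: f + g).
Proof.
have [_ cl] := Lfun2_submod.
case=> f1 f2 [g1 g2]; split.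
  rewrite (_ : (fun _ => _) =
    a *: (fun x => complex.Re (f x)) + (fun x => complex.Re (g x))); first exact: cl.
  by apply/funext => x; rewrite !fctE; case: (f x) (g x) => [? ?] [? ?].
rewrite (_ : (fun _ => _) =
  a *: (fun x => complex.Im (f x)) + (fun x => complex.Im (g x))); first exact: cl.
by apply/funext => x; rewrite !fctE; case: (f x) (g x) => [? ?] [? ?].
Qed.

Lemma square_integrable0 : square_integrable 0.
Proof. by have [cl0 _] := Lfun2_submod; split; exact: cl0. Qed.

Lemma compact_Lfun2 (f : R -> R) (K : set R) : continuous f -> compact K ->
  (forall x, ~ K x -> f x = 0) -> f \in Lfun mu 2%:E.
Proof.
move=> cf cK fK; have mf : measurable_fun setT f by exact: continuous_measurable_fun.
have mK : measurable K by exact: compact_measurable.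
rewrite inE; apply/andP; split; rewrite inE//=.
rewrite /finite_norm unlock /=.
apply: poweR_lty.
have -> : (fun x : R => (`|f x| `^ 2)%:E) = (fun x => (f x ^+ 2)%:E) \_ K.
  apply/funext => x; rewrite patchE powR_mulrn// real_normK ?num_real//.
  by case: ifPn => //; rewrite notin_setE => /fK ->; rewrite expr0n.
rewrite -integral_mkcond.
have /integrableP[_] : mu.-integrable K (EFin \o (fun x => f x ^+ 2)).
  apply: continuous_compact_integrable => //; apply: continuous_subspaceT.
  by move=> x; apply: cvgM; exact: cf.
apply: le_lt_trans; rewrite le_eqVlt; apply/orP; left; apply/eqP.
by apply: eq_integral => x _ /=; rewrite ger0_norm ?sqr_ge0.
Qed.

Lemma test_function_Lfun2 (phi : R -> R) : test_function phi ->
  phi \in Lfun mu 2%:E /\ derive1 phi \in Lfun mu 2%:E.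
Proof.
move=> [sm cK]; set K := closure _ in cK.
have phi0 x : ~ K x -> phi x = 0.
  move=> nK; apply/eqP/negP => /negP nx; apply: nK.
  exact: subset_closure.
have ct n : continuous (derive1n n phi).
  by move=> x; apply/differentiable_continuous/derivable1_diffP/(sm n x).
split.
  exact: (compact_Lfun2 (ct 0%N) cK phi0).
apply: (compact_Lfun2 (ct 1%N) cK) => x nK.
rewrite derive1n1 derive1E (@near_eq_derive _ _ _ _ (cst 0))//.
  exact: derive_cst.
have : open (~` K) by apply: closed_openC; exact: closed_closure.
by rewrite openE => /(_ x nK); apply: filterS => y /phi0.
Qed.

Lemma integrable_Lfun2 (f g : R -> R) :
  f \in Lfun mu 2%:E -> g \in Lfun mu 2%:E ->
  mu.-integrable setT (EFin \o (fun x => f x * g x)).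
Proof. by move=> hf hg; apply/Lfun1_integrable; exact: Lfun2_mul_Lfun1. Qed.

Lemma cintegral_lin (phi : R -> R) (a : R) (f g : R -> C) :
  phi \in Lfun mu 2%:E -> square_integrable f -> square_integrable g ->
  cintegral (fun x => phi x *: (a *: f + g) x) =
  a *: cintegral (fun x => phi x *: f x) + cintegral (fun x => phi x *: g x).
Proof.
move=> hp [f1 f2] [g1 g2].
have RI (p q : R -> R) : p \in Lfun mu 2%:E -> q \in Lfun mu 2%:E ->
    \int[mu]_x (phi x * (a * p x + q x)) =
    a * \int[mu]_x (phi x * p x) + \int[mu]_x (phi x * q x).
  move=> hP hq; have ip := integrable_Lfun2 hp hP; have iq := integrable_Lfun2 hp hq.
  rewrite -RintegralZl// -RintegralD//; last by have := integrableZl measurableT a ip.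
  by apply: eq_Rintegral => x _; ring.
rewrite /cintegral.
have -> : (fun x => complex.Re (phi x *: (a *: f + g) x : C)) =
    (fun x => phi x * (a * complex.Re (f x) + complex.Re (g x))).
  by apply/funext => x; rewrite !fctE; case: (f x) (g x) => [? ?] [? ?].
have -> : (fun x => complex.Im (phi x *: (a *: f + g) x : C)) =
    (fun x => phi x * (a * complex.Im (f x) + complex.Im (g x))).
  by apply/funext => x; rewrite !fctE; case: (f x) (g x) => [? ?] [? ?].
rewrite !RI//.
have E (h : R -> C) : [/\ (fun x => complex.Re (phi x *: h x)) =
   (fun x => phi x * complex.Re (h x)) & (fun x => complex.Im (phi x *: h x)) =
   (fun x => phi x * complex.Im (h x))].
  by split; apply/funext => x; case: (h x).
by have [-> ->] := E f; have [-> ->] := E g.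
Qed.

Lemma sobolev_graph_submod : submod_closed sobolev_graph.
Proof.
split=> [|a [f f'] [g g']].
  apply/asboolP; split; [exact: square_integrable0|exact: square_integrable0|].
  move=> phi _; have E (p : R -> R) : cintegral (fun x => p x *: (0 : R -> C) x) = 0.
    have -> : (fun x => p x *: (0 : R -> C) x) = (fun=> 0).
      by apply/funext => x; exact: scaler0.
    by rewrite /cintegral /= /Rintegral integral0.
  by rewrite !E oppr0.
move=> /asboolP/= [f1 f2 wf] /asboolP/= [g1 g2 wg]; apply/asboolP; split => /=.
- exact: square_integrable_lin.
- exact: square_integrable_lin.
- move=> phi hphi; have [p0 p1] := test_function_Lfun2 hphi.
  by rewrite !cintegral_lin// wf// wg// scalerN opprD.
Qed.

End SobolevGraph.

Section SobolevSpace.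
Variable R : realType.
Local Notation mu := (@lebesgue_measure R).
Local Notation C := (Rcomplex R).

HB.instance Definition _ := GRing.isSubmodClosed.Build R ((R -> C) * (R -> C))%type
  (@sobolev_graph R) (@sobolev_graph_submod R).

(* H^1(R, C) is encoded as the graph of the weak derivative: an element carries
   an L^2 function together with its weak derivative in L^2. The latter is
   determined a.e. by the former, so no information is added. *)
Record weak_pair := WeakPair {
  weak_pair_val :> (R -> C) * (R -> C);
  _ : weak_pair_val \in @sobolev_graph R }.

HB.instance Definition _ := [isSub for weak_pair_val].
HB.instance Definition _ := [Choice of weak_pair by <:].
HB.instance Definition _ := [SubChoice_isSubLmodule of weak_pair by <:].

Definition ae_zero : {pred weak_pair} :=
  [pred z : weak_pair | `[< {ae mu, forall x, z.1 x = 0 /\ z.2 x = 0} >] ].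

Lemma ae_zero_zmod : zmod_closed ae_zero.
Proof.
split=> [|z w /asboolP z0 /asboolP w0]; apply/asboolP; first exact: aeW.
move: z0 w0; apply: (@filterS2 _ _ (ae_filter_ringOfSetsType mu)) => x /= [z1 z2] [w1 w2]; split.
  by rewrite -[LHS]/(z.1 x - w.1 x) z1 w1 subrr.
by rewrite -[LHS]/(z.2 x - w.2 x) z2 w2 subrr.
Qed.

HB.instance Definition _ := GRing.isZmodClosed.Build weak_pair ae_zero ae_zero_zmod.

(* Pairs of functions equal almost everywhere are identified. *)
Definition H1 : Type := Quotient.quot ae_zero.

HB.instance Definition _ := Choice.on H1.
HB.instance Definition _ := GRing.Zmodule.on H1.
HB.instance Definition _ : EqQuotient weak_pair (Quotient.equiv ae_zero) H1 :=
  EqQuotient.on H1.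


Definition h1_fun (u : H1) : R -> C := (repr u).1.
Definition h1_deriv (u : H1) : R -> C := (repr u).2.

Lemma pi_H1_eq (z w : weak_pair) : z - w \in ae_zero -> \pi_H1 z = \pi_H1 w.
Proof. by move=> zw; apply/eqP; rewrite -Quotient.idealrBE. Qed.

Lemma repr_pi_H1 (z : weak_pair) : repr (\pi_H1 z) - z \in ae_zero.
Proof. by rewrite Quotient.idealrBE reprK. Qed.

Lemma ae_zeroZ (a : R) (z : weak_pair) : z \in ae_zero -> a *: z \in ae_zero.
Proof.
move=> /asboolP z0; apply/asboolP; move: z0.
apply: (@filterS _ _ (ae_filter_ringOfSetsType mu)) => x /= [z1 z2]; split.
  by rewrite -[LHS]/(a *: z.1 x) z1 scaler0.
by rewrite -[LHS]/(a *: z.2 x) z2 scaler0.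
Qed.

Definition h1_scale (a : R) (u : H1) : H1 := \pi_H1 (a *: repr u).

Lemma pi_scale (a : R) (z : weak_pair) :
  h1_scale a (\pi_H1 z) = \pi_H1 (a *: z).
Proof. by apply: pi_H1_eq; rewrite -scalerBr; apply/ae_zeroZ/repr_pi_H1. Qed.

Lemma pi_H1D (z w : weak_pair) : \pi_H1 z + \pi_H1 w = \pi_H1 (z + w).
Proof. by symmetry; exact: (Quotient.pi_add ae_zero z w). Qed.

Lemma h1_scalerA (a b : R) (u : H1) : h1_scale a (h1_scale b u) = h1_scale (a * b) u.
Proof. by rewrite -[u]reprK (pi_scale b) (pi_scale a) (pi_scale (a * b)) scalerA. Qed.
Lemma h1_scale1r : left_id 1 h1_scale.
Proof. by move=> u; rewrite -[u]reprK pi_scale scale1r. Qed.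
Lemma h1_scalerDr : right_distributive h1_scale +%R.
Proof. by move=> a u v; rewrite -[u]reprK -[v]reprK !(pi_scale a (repr _)) !pi_H1D (pi_scale a) scalerDr. Qed.
Lemma h1_scalerDl (u : H1) : {morph h1_scale^~ u : a b / a + b}.
Proof. by move=> a b; rewrite -[u]reprK (pi_scale a) (pi_scale b) (pi_scale (a + b)) pi_H1D scalerDl. Qed.

HB.instance Definition _ := GRing.Zmodule_isLmodule.Build R H1
  h1_scalerA h1_scale1r h1_scalerDr h1_scalerDl.

Let dens (z w : (R -> C) * (R -> C)) (x : R) : R :=
  complex.Re (z.1 x * (conjc (w.1 x) : C) + z.2 x * (conjc (w.2 x) : C)).

Let ip (z w : weak_pair) : R := \int[mu]_x dens z w x.

Let densE (z w : weak_pair) x : dens z w x =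
  complex.Re (z.1 x) * complex.Re (w.1 x) + complex.Im (z.1 x) * complex.Im (w.1 x) +
  (complex.Re (z.2 x) * complex.Re (w.2 x) + complex.Im (z.2 x) * complex.Im (w.2 x)).
Proof.
rewrite /dens; case: (z.1 x) (z.2 x) (w.1 x) (w.2 x) => [a b] [c d] [e f] [g h] /=.
by rewrite !mulrN !opprK.
Qed.

Let dens_int (z w : weak_pair) : mu.-integrable setT (EFin \o dens z w).
Proof.
case: z w => [[z1 z2] hz] [[w1 w2] hw].
have /asboolP[/= [a b] [c d] _] := hz.
have /asboolP[/= [a' b'] [c' d'] _] := hw.
have := integrableD measurableT
  (integrableD measurableT (integrable_Lfun2 a a') (integrable_Lfun2 b b'))
  (integrableD measurableT (integrable_Lfun2 c c') (integrable_Lfun2 d d')).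
apply: eq_integrable => // x _.
exact: (esym (congr1 EFin (densE (WeakPair hz) (WeakPair hw) x))).
Qed.

Let ipD (z z' w : weak_pair) (a b : R) :
  ip (a *: z + b *: z') w = a * ip z w + b * ip z' w.
Proof.
rewrite /ip -!RintegralZl// -RintegralD//.
- apply: eq_Rintegral => x _; rewrite !densE.
  rewrite -[(a *: z + b *: z').1 x]/(a *: z.1 x + b *: z'.1 x).
  rewrite -[(a *: z + b *: z').2 x]/(a *: z.2 x + b *: z'.2 x).
  case: (z.1 x) (z.2 x) (z'.1 x) (z'.2 x) => [? ?] [? ?] [? ?] [? ?] /=; ring.
- by have := integrableZl measurableT a (dens_int z w).
- by have := integrableZl measurableT b (dens_int z' w).
Qed.

Let ipC (z w : weak_pair) : ip z w = ip w z.
Proof. by apply: eq_Rintegral => x _; rewrite !densE; ring. Qed.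

Let ip_ge0 (z : weak_pair) : 0 <= ip z z.
Proof.
by apply: Rintegral_ge0 => x _; rewrite densE -!expr2 !addr_ge0// sqr_ge0.
Qed.

Let ip_eq0 (z : weak_pair) : ip z z = 0 -> z \in ae_zero.
Proof.
move=> i0; have d0 x : 0 <= dens z z x.
  by rewrite densE -!expr2 !addr_ge0// sqr_ge0.
have /integrableP[md _] := dens_int z z.
have : (\int[mu]_(x in setT) `|(EFin \o dens z z) x| = 0)%E.
  under eq_integral => x _ do rewrite /= ger0_norm//.
  have fi : (\int[mu]_x (dens z z x)%:E)%E \is a fin_num.
    exact: integrable_fin_num (dens_int z z).
  by rewrite -(fineK fi) -[X in X%:E]/(ip z z) i0.
move=> /(ae_eq_integral_abs mu measurableT md) ae0; apply/asboolP; move: ae0.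
apply: (@filterS _ _ (ae_filter_ringOfSetsType mu)) => x /(_ I) /= [].
rewrite densE; case: (z.1 x) (z.2 x) => [a b] [c d] /= h.
have ha : a = 0 by nra.
have hb : b = 0 by nra.
have hc : c = 0 by nra.
have hd : d = 0 by nra.
by rewrite ha hb hc hd.
Qed.

Let ip_ae (z z' w : weak_pair) : z - z' \in ae_zero -> ip z w = ip z' w.
Proof.
move=> /asboolP h; rewrite /ip /Rintegral; congr fine.
apply: ae_eq_integral => //.
- by have /integrableP[] := dens_int z w.
- by have /integrableP[] := dens_int z' w.
move: h; apply: (@filterS _ _ (ae_filter_ringOfSetsType mu)) => x /= [h1 h2] _.
have {}h1 : z.1 x = z'.1 x by apply/eqP; rewrite -subr_eq0; apply/eqP.
have {}h2 : z.2 x = z'.2 x by apply/eqP; rewrite -subr_eq0; apply/eqP.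
by rewrite /dens h1 h2.
Qed.

Definition h1_inner (u v : H1) : R :=
  \int[mu]_x complex.Re (h1_fun u x * (conjc (h1_fun v x) : C) +
                         h1_deriv u x * (conjc (h1_deriv v x) : C)).

Let h1_inner_pi z w : h1_inner (\pi_H1 z) (\pi_H1 w) = ip z w.
Proof.
rewrite -[LHS]/(ip (repr (\pi_H1 z)) (repr (\pi_H1 w))).
by rewrite (ip_ae _ (repr_pi_H1 z)) ipC (ip_ae _ (repr_pi_H1 w)) ipC.
Qed.

Lemma h1_inner_linl (w u v : H1) (a b : R) :
  h1_inner (a *: u + b *: v) w = a * h1_inner u w + b * h1_inner v w.
Proof.
rewrite -[u]reprK -[v]reprK -[w]reprK.
rewrite -[a *: _]/(h1_scale _ _) -[b *: _]/(h1_scale _ _) !pi_scale pi_H1D.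
by rewrite !h1_inner_pi ipD.
Qed.

Lemma h1_innerC (u v : H1) : h1_inner u v = h1_inner v u.
Proof. exact: ipC. Qed.

Lemma h1_inner_ge0 (u : H1) : 0 <= h1_inner u u.
Proof. exact: ip_ge0. Qed.

Lemma h1_inner_eq0 (u : H1) : h1_inner u u = 0 -> u = 0.
Proof.
move=> /ip_eq0 h; rewrite -[u]reprK -[0]/(0 : Quotient.quot ae_zero).
by rewrite -(raddf0 \pi_(Quotient.quot ae_zero)); apply: pi_H1_eq; rewrite subr0.
Qed.

Lemma h1_cauchy_schwarz (u v : H1) :
  h1_inner u v ^+ 2 <= h1_inner u u * h1_inner v v.
Proof.
set a := h1_inner u u; set b := h1_inner u v; set c := h1_inner v v.
have q (t : R) : 0 <= a + 2 * t * b + t ^+ 2 * c.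
  have := h1_inner_ge0 (1 *: u + t *: v).
  rewrite h1_inner_linl (h1_innerC u) (h1_innerC v) !h1_inner_linl.
  rewrite (h1_innerC v u) -/a -/b -/c; lra.
have c0 : 0 <= c by exact: h1_inner_ge0.
have [cz|cp] : c = 0 \/ 0 < c by move: c0; rewrite le_eqVlt => /orP[/eqP<-|]; [left|right].
  rewrite cz mulr0; have [->|b0] := eqVneq b 0; first by rewrite expr0n.
  have := q (- (a + 1) / (2 * b)); rewrite cz mulr0 addr0.
  by rewrite (_ : a + _ = -1) ?oppr_ge0 ?ler10//; field.
have := q (- b / c); rewrite (_ : a + _ + _ = (a * c - b ^+ 2) / c); last first.
  by field; exact: lt0r_neq0.
by rewrite pmulr_lge0 ?invr_gt0// subr_ge0.
Qed.

Definition h1_norm (u : H1) : R := Num.sqrt (h1_inner u u).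

Lemma h1_normD (u v : H1) : h1_norm (u + v) <= h1_norm u + h1_norm v.
Proof.
rewrite -(@ler_pXn2r _ 2%N)// ?nnegrE ?addr_ge0 ?sqrtr_ge0//.
rewrite sqrrD !sqr_sqrtr ?h1_inner_ge0//.
have -> : h1_inner (u + v) (u + v) =
    h1_inner u u + h1_inner u v *+ 2 + h1_inner v v.
  rewrite -[u + v](_ : 1 *: u + 1 *: v = _); last by rewrite !scale1r.
  rewrite h1_inner_linl (h1_innerC u) (h1_innerC v) !h1_inner_linl.
  rewrite (h1_innerC v u); ring.
rewrite lerD2r lerD2l lerMn2r/=.
rewrite -sqrtrM ?h1_inner_ge0//.
apply: le_trans (ler_norm _) _.
by rewrite -sqrtr_sqr ler_wsqrtr// h1_cauchy_schwarz.
Qed.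

Lemma h1_normZ (a : R) (u : H1) : h1_norm (a *: u) = `|a| * h1_norm u.
Proof.
rewrite /h1_norm (_ : h1_inner _ _ = a ^+ 2 * h1_inner u u).
  by rewrite sqrtrM ?sqr_ge0// sqrtr_sqr.
have -> : a *: u = a *: u + 0 *: u by rewrite scale0r addr0.
by rewrite h1_inner_linl (h1_innerC u) h1_inner_linl; ring.
Qed.

Lemma h1_norm0_eq0 (u : H1) : h1_norm u = 0 -> u = 0.
Proof.
move=> /eqP; rewrite sqrtr_eq0 => h; apply: h1_inner_eq0.
by apply/eqP; rewrite eq_le h h1_inner_ge0.
Qed.

(* The H^1 norm makes [H1] a normed module over [R]; in particular elements of
   [H1] are differentiated with respect to this norm. *)
HB.instance Definition _ := Lmodule_isNormed.Build R H1
  h1_normD h1_normZ h1_norm0_eq0.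

End SobolevSpace.

Section Calculus.
Variables (R : realType) (E : normedModType R).

(* Derivatives are taken relatively to [J], hence are one-sided at the endpoints
   when [J] is a closed interval. *)
Definition slope_within (J : set R) (f : R -> E) (x : R) : set_system E :=
  (fun h : R => h^-1 *: (f (x + h) - f x)) @ within (fun h => J (x + h)) 0^'.

Definition derivative_within (J : set R) (f : R -> E) (x : R) : E :=
  lim (slope_within J f x).

(* C^oo on [J]: [g n] is the [n]-th derivative of [f] on [J]. *)
Definition smooth_on (J : set R) (f : R -> E) : Prop :=
  exists g : nat -> R -> E,
    (forall x, J x -> g 0%N x = f x) /\
    (forall n x, J x -> slope_within J (g n) x --> g n.+1 x).

(* C^oo on [I `*` J]: all iterated partial derivatives exist and are jointly
   continuous; [G m n] is the one of order [m] in the first variable and [n] in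
   the second one. *)
Definition smooth_on2 (I J : set R) (F : R -> R -> E) : Prop :=
  exists G : nat -> nat -> R -> R -> E,
    [/\ forall r s, I r -> J s -> G 0%N 0%N r s = F r s,
        forall m n, {within I `*` J, continuous (fun z : R * R => G m n z.1 z.2)},
        forall m n r s, I r -> J s ->
          slope_within I (fun r' => G m n r' s) r --> G m.+1 n r s
      & forall m n r s, I r -> J s ->
          slope_within J (G m n r) s --> G m n.+1 r s].

End Calculus.

Section ActionFunctional.
Variables (R : realType) (p : R).
Local Notation mu := (@lebesgue_measure R).
Local Notation C := (Rcomplex R).
Local Notation V := (H1 R).
Local Notation W := (V * R)%type.

Definition omega (u v : V) : R :=
  complex.Im (cintegral (fun x => h1_fun u x * (conjc (h1_fun v x) : C))).

Definition hamiltonian (u : V) : R :=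
  \int[mu]_x (4^-1 * `|h1_deriv u x| ^+ 2
              - (p + 1)^-1 * `|h1_fun u x| `^ (p + 1)).

Definition d_hamiltonian (u v : V) : R :=
  derive1 (fun s : R => hamiltonian (u + s *: v)) 0.

Definition alpha (z w : W) : R := 2^-1 * omega z.1 w.1 - hamiltonian z.1 * w.2.

(* d alpha ((v1, T1), (v2, T2)) = omega(v1, v2) - dH(v1) T2 + dH(v2) T1. *)
Definition omega_tilde (z w1 w2 : W) : R :=
  omega w1.1 w2.1 - d_hamiltonian z.1 w1.1 * w2.2 + d_hamiltonian z.1 w2.1 * w1.2.

Definition ker_omega_tilde (z : W) : set W :=
  [set w | forall w', omega_tilde z w w' = 0].

Definition action (a b : R) (gamma : R -> W) : R :=
  \int[mu]_(s in `[a, b]) alpha (gamma s) (derivative_within `[a, b] gamma s).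

(* Curves are total functions on [R] of which only the values on [`[a, b]]
   matter. The compact [K] outside of which [Gamma r] agrees with [gamma] does
   not depend on [r]. *)
Definition critical (a b : R) (gamma : R -> W) : Prop :=
  forall (eps : R) (Gamma : R -> R -> W), 0 < eps ->
    smooth_on2 `]- eps, eps[ `[a, b] Gamma ->
    (forall s, s \in `[a, b] -> Gamma 0 s = gamma s) ->
    (exists2 K : set R, compact K /\ K `<=` `]a, b[ &
       forall r s, r \in `]- eps, eps[ -> s \in `[a, b] -> ~ K s ->
         Gamma r s = gamma s) ->
    is_derive (0 : R) (1 : R) (fun r => action a b (Gamma r)) 0.

End ActionFunctional.

(* Main.v *)
Require Import Defs.
From mathcomp Require Import all_boot all_order all_algebra.
From mathcomp Require Import all_classical all_reals all_analysis.
From mathcomp Require Import measurable_realfun complex.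
From mathcomp Require Import ring lra.
Import numFieldNormedType.Exports.
Local Open Scope ring_scope.

(** Along a family of curves depending on a parameter, let [w] and [w'] be the
    derivatives in the parameter and along the curve. Since [omega_tilde] is the
    exterior derivative of [alpha], the derivative of [alpha w'] in the parameter is the
    derivative of [alpha w] along the curve plus [omega_tilde w w']
    ([d_alpha_omega_tilde]). When the endpoints are fixed, [alpha w] vanishes there, so
    the derivative of the action is the integral of [omega_tilde w w']
    ([action_variation]). It vanishes if the velocity [w'] lies in the kernel.
    Conversely, for the linear variation in a fixed direction [w0], multiplied by a bump
    [eta], the formula gives that the integral of [eta] times [omega_tilde w0 w'] is 0.
    As this holds for every bump, the continuous function [omega_tilde w0 w'] vanishes
    on the whole interval.

    This argument needs that [alpha] is of class C^1. The form [omega] is bilinear and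
    bounded, so the point is that the energy is C^1 on H^1. Pointwise, the convexity of
    |z| ^ (p + 1) gives a first order Taylor expansion with a remainder at most quadratic
    in the increment, as long as z remains bounded ([powR_taylor]); it comes from the
    tangent inequality of convexity used at both points, together with a local Lipschitz
    estimate for |z| ^ (p - 1) z ([powR_field_lip]). Functions of H^1 are bounded almost
    everywhere by a multiple of their norm ([sobolev_bound]), so these estimates can be
    integrated ([grad_lip], [ham_taylor]).

    The Sobolev bound is derived directly from the weak derivative. The difference of two
    bumps with the same centre x and the same integral is the derivative of a bounded
    function supported near x. Hence the averages of u against bumps shrinking to x differ
    from its average against a fixed bump by at most a multiple of the norm of u', and at a
    Lebesgue point x these averages converge to a fixed multiple of u(x). *)

Module CriticalCurves.
Set Implicit Arguments.
Unset Strict Implicit.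
Unset Printing Implicit Defensive.
Import Order.TTheory GRing.Theory Num.Theory.
Local Open Scope classical_set_scope.
Local Open Scope ring_scope.

(** * Smooth functions and bumps *)

Section Smooth.
Variable R : realType.
Implicit Types f g : R -> R.

(** Smooth functions on the line, in the form used for test functions. *)
Definition smooth_fun f := forall n x, derivable (derive1n n f) x 1.

(** [f] is [n] times differentiable; contrary to [smooth_fun], this is defined by
    recursion on the derivative, which suits proofs by induction. *)
Fixpoint ndiff n f : Prop :=
  if n is m.+1 then (forall x : R, derivable f x 1) /\ ndiff m (derive1 f) else True.

Lemma derive1n_derive1 n f : derive1n n (derive1 f) = derive1n n.+1 f.
Proof. by rewrite derive1Sn. Qed.

Lemma smooth_ndiff f : smooth_fun f <-> forall n, ndiff n f.
Proof.
split=> [sf n|nf n].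
  elim: n f sf => // n IH f sf; split; first exact: (sf 0%N).
  by apply: IH => m x; rewrite derive1n_derive1; exact: sf.
elim: n f nf => [|n IH] f nf x; first by have [] := nf 1%N.
by rewrite derive1Sn; apply: IH => m; have [] := nf m.+1.
Qed.

Lemma ndiffS n f : ndiff n.+1 f -> ndiff n f.
Proof. by elim: n f => // n IH f [df nf]; split => //; exact: IH. Qed.

Lemma ndiffD n f g : ndiff n f -> ndiff n g -> ndiff n (f + g).
Proof.
elim: n f g => // n IH f g [df nf] [dg ng]; split.
  by move=> x; exact: derivableD.
rewrite (_ : derive1 _ = derive1 f + derive1 g); first exact: IH.
by apply/funext => x; rewrite !fctE !derive1E deriveD.
Qed.

Lemma ndiffM n f g : ndiff n f -> ndiff n g -> ndiff n (f * g).
Proof.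
elim: n f g => // n IH f g nf ng.
have nf' := ndiffS nf; have ng' := ndiffS ng.
case: nf ng => [df nf] [dg ng]; split.
  by move=> x; exact: derivableM.
rewrite (_ : derive1 _ = f * derive1 g + g * derive1 f).
  by apply: ndiffD; exact: IH.
apply/funext => x; rewrite derive1E deriveM; [|exact: df|exact: dg].
by rewrite -!derive1E.
Qed.

Lemma ndiff_cst n (c : R) : ndiff n (cst c).
Proof.
elim: n c => // n IH c; split; first by move=> x; exact: derivable_cst.
by rewrite (_ : derive1 _ = cst 0) // ; apply/funext => x; rewrite derive1E; exact: derive_cst.
Qed.

Lemma is_derive_affine (c d x : R) f l : is_derive (c * x + d) 1 f l ->
  is_derive x 1 (fun t => f (c * t + d)) (c * l).
Proof.
move=> h; have := @is_derive1_comp R f (fun t => c * t + d) x l c h.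
rewrite mulrC; apply.
have := @is_deriveD _ _ _ (fun t => c * t) (cst d) x 1 c 0.
rewrite addr0; apply.
rewrite (_ : (fun t => _) = c *: id); last by apply/funext => t.
apply: is_derive_eq; exact: mulr1.
Qed.

Lemma ndiff_affine n (c d : R) f : ndiff n f -> ndiff n (fun x => f (c * x + d)).
Proof.
elim: n f => // n IH f [df nf].
have D (x : R) : is_derive x 1 (fun t => f (c * t + d)) (c * derive1 f (c * x + d)).
  by apply: is_derive_affine; rewrite derive1E; apply: DeriveDef.
split; first by move=> x; case: (D x).
rewrite (_ : derive1 _ = cst c * (fun x => derive1 f (c * x + d))).
  by apply: ndiffM; [exact: ndiff_cst|exact: IH].
by apply/funext => x; rewrite derive1E; case: (D x).
Qed.

Lemma smoothD f g : smooth_fun f -> smooth_fun g -> smooth_fun (f + g).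
Proof. by rewrite !smooth_ndiff => sf sg n; exact: ndiffD. Qed.

Lemma smoothM f g : smooth_fun f -> smooth_fun g -> smooth_fun (f * g).
Proof. by rewrite !smooth_ndiff => sf sg n; exact: ndiffM. Qed.

Lemma smooth_cst c : smooth_fun (cst c).
Proof. by rewrite smooth_ndiff => n; exact: ndiff_cst. Qed.

Lemma smooth_affine (c d : R) f : smooth_fun f -> smooth_fun (fun x => f (c * x + d)).
Proof. by rewrite !smooth_ndiff => sf n; exact: ndiff_affine. Qed.

Lemma smooth_primitive f g : (forall x : R, is_derive x 1 f (g x)) ->
  smooth_fun g -> smooth_fun f.
Proof.
move=> D; rewrite !smooth_ndiff => sg [//|n]; split.
  by move=> x; case: (D x).
by rewrite (_ : derive1 f = g) //; apply/funext => x; rewrite derive1E; case: (D x).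
Qed.

Lemma smooth_continuous f : smooth_fun f -> continuous f.
Proof. by move=> sf x; apply/differentiable_continuous/derivable1_diffP/(sf 0%N). Qed.

(** The function q(1/x) exp(-1/x) for x > 0, extended by 0 to x <= 0. The family
    of these functions, [q] ranging over the polynomials, is stable under
    differentiation, whence their smoothness. *)
Definition flat (q : {poly R}) (x : R) : R :=
  if 0 < x then q.[x^-1] * expR (- x^-1) else 0.

Lemma horner_growth (q : {poly R}) : exists n (C : R), 0 <= C /\
  forall y, 1 <= y -> `|q.[y]| <= C * y ^+ n.
Proof.
elim/poly_ind: q => [|q c [n [C [C0 qC]]]].
  by exists 0%N, 0; split => // y _; rewrite horner0 normr0 mul0r.
exists n.+1, (C + `|c|); split; first by rewrite addr_ge0.
move=> y y1; rewrite hornerMXaddC (le_trans (ler_normD _ _))// mulrDl lerD//.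
  rewrite normrM exprSr mulrA (ger0_norm (le_trans ler01 y1)).
  by rewrite ler_wpM2r ?qC// (le_trans ler01).
by rewrite ler_peMr// exprn_ege1.
Qed.

Lemma flat_lim (q : {poly R}) :
  (fun x => q.[x^-1] * expR (- x^-1)) x @[x --> 0^'+] --> 0.
Proof.
have [n [C [C0 qC]]] := horner_growth q.
apply: norm_cvg0.
apply: (@squeeze_cvgr _ _ _ _ (cst 0) (fun x => C * (n.+1)`!%:R * x)).
(* For y = 1/x >= 1, y ^ (n + 1) is at most (n + 1)! exp y. *)
- near=> x; rewrite normr_ge0/= normrM (ger0_norm (expR_ge0 _)).
  have x0 : 0 < x by near: x; exact: nbhs_right_gt.
  have x1 : 1 <= x^-1.
    by rewrite invf_ge1//; near: x; exact: nbhs_right_le.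
  rewrite expRN.
  have y0 : 0 < x^-1 by rewrite invr_gt0.
  have E : (x^-1) ^+ n.+1 <= (n.+1)`!%:R * expR x^-1.
    rewrite mulrC -ler_pdivrMr ?ltr0n ?fact_gt0//.
    by apply: le_trans (@expR_ge1Dxn R _ n (ltW y0)); rewrite lerDr.
  rewrite ler_pdivrMr ?expR_gt0//.
  rewrite (le_trans (qC _ x1))// -!mulrA ler_wpM2l//.
  rewrite -(ler_pM2r y0) -exprSr (le_trans E)//.
  rewrite [leRHS](_ : _ = (n.+1)`!%:R * expR x^-1)//.
  by field; rewrite gt_eqF.
- exact: cvg_cst.
- rewrite -[X in _ --> X](mulr0 (C * (n.+1)`!%:R)).
  apply: cvgM; first exact: cvg_cst.
  by apply: cvg_at_right_filter; exact: cvg_id.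
Unshelve. all: by end_near. Qed.

End Smooth.

Section Bump.
Variable R : realType.
Implicit Types f g : R -> R.

Lemma flat_derive (q : {poly R}) (x : R) :
  is_derive x 1 (flat q) (flat ('X^2 * (q - q^`())) x).
Proof.
have [x0|x0|->] := ltgtP x 0.
- rewrite {2}/flat ltNge (ltW x0)/=.
  apply: (near_eq_is_derive _ (is_derive_cst (0 : R) _ _)).
  near=> y; rewrite /flat ltNge (_ : y <= 0)//; near: y.
  by apply: filterS (lt_nbhsl x0) => y /ltW.
- rewrite {2}/flat x0.
  have xn0 : x != 0 by rewrite gt_eqF.
  pose g : R -> R := (fun z => q.[z]) * (expR \o (fun z => -1 * z + 0)).
  have dg (z : R) : is_derive z 1 g (q^`().[z] * expR (- z) - q.[z] * expR (- z)).
    have e : is_derive z 1 (expR \o (fun z : R => -1 * z + 0)) (-1 * expR (-1 * z + 0)).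
      exact: is_derive_affine.
    apply: (is_derive_eq (is_deriveM (is_derive_poly q z) e)).
    rewrite /= /GRing.scale/= !mulN1r addr0; ring.
  have dV : is_derive x 1 (fun y : R => y^-1) (- x ^- 2).
    apply: (is_derive_eq (is_deriveV xn0 (is_derive_id x 1))).
    by rewrite /GRing.scale/= mulr1.
  have := is_derive1_comp (dg x^-1) dV.
  move=> h; have {}h : is_derive x 1 (g \o (fun y : R => y^-1))
      (('X^2 * (q - q^`())).[x^-1] * expR (- x^-1)).
    apply: (is_derive_eq h); rewrite !hornerE; field; exact: xn0.
  apply: (near_eq_is_derive _ h).
  near=> y; rewrite /flat (_ : 0 < y); last by near: y; exact: lt_nbhsr.
  by rewrite /g !fctE /= addr0 mulN1r.
(* At 0, the slopes are 0 on the left, and those of a function of the same family on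
   the right. *)
- pose S (h : R) : R := h^-1 *: (flat q (h + 0) - flat q 0).
  have L : S h @[h --> (0 : R)^'] --> (0 : R).
    apply: (@cvg_at_right_left_dnbhs _ R^o).
      have := @flat_lim R ('X * q).
      apply: cvg_trans; apply: near_eq_cvg; near=> h.
      have h0 : 0 < h by near: h; exact: nbhs_right_gt.
      by rewrite /S /flat addr0 h0 ltxx subr0 !hornerE/= /GRing.scale/=; ring.
    apply: (@cvg_trans _ ((fun=> 0 : R) @ (0 : R)^'-)); last exact: cvg_cst.
    apply: near_eq_cvg; near=> h.
    have h0 : h < 0 by near: h; exact: nbhs_left_lt.
    by rewrite /S /flat addr0 ltxx ltNge (ltW h0)/= subr0 scaler0.
  rewrite {2}/flat ltxx; apply: DeriveDef.
    by apply/cvg_ex; exists 0; under eq_fun do rewrite scaler1.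
  by apply/cvg_lim => //; under eq_fun do rewrite scaler1.
Unshelve. all: by end_near.
Qed.

(** The function exp(-1/x) for x > 0. *)
Definition flat0 : R -> R := flat 1.

Lemma smooth_flat q : smooth_fun (@flat R q).
Proof.
rewrite smooth_ndiff => n; elim: n q => // n IH q; split.
  by move=> x; case: (flat_derive q x).
rewrite (_ : derive1 _ = flat ('X^2 * (q - q^`()))) //.
by apply/funext => x; rewrite derive1E; case: (flat_derive q x).
Qed.

(** A smooth function, positive on ]-1, 1[ and zero elsewhere. *)
Definition bump (x : R) : R := flat0 (1 + x) * flat0 (1 - x).

Lemma flat0_ge0 x : 0 <= flat0 x.
Proof.
rewrite /flat0 /flat; case: ifP => // _.
by rewrite hornerC mul1r expR_ge0.
Qed.

Lemma flat0_gt0 x : (0 < flat0 x) = (0 < x).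
Proof.
rewrite /flat0 /flat; case: (0 < x); last exact: ltxx.
by rewrite hornerC mul1r expR_gt0.
Qed.

Lemma flat0_le1 x : flat0 x <= 1.
Proof.
rewrite /flat0 /flat; case: ifP => // x0.
by rewrite hornerC mul1r expR_le1 oppr_le0 invr_ge0 ltW.
Qed.

Lemma smooth_bump : smooth_fun bump.
Proof.
have -> : bump = (fun x => flat0 (1 * x + 1)) * (fun x => flat0 (-1 * x + 1)).
  by apply/funext => x; rewrite !fctE mul1r mulN1r [x + 1]addrC [- x + 1]addrC.
by apply: smoothM; apply: smooth_affine; exact: smooth_flat.
Qed.

Lemma bump_ge0 x : 0 <= bump x.
Proof. by rewrite mulr_ge0 ?flat0_ge0. Qed.

Lemma bump_le1 x : bump x <= 1.
Proof. by rewrite mulr_ile1 ?flat0_ge0 ?flat0_le1. Qed.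

Lemma bump_gt0 x : (0 < bump x) = (`|x| < 1).
Proof.
have [x1|x1] := ltP `|x| 1.
  have := x1; rewrite ltr_norml => /andP[a b].
  by rewrite mulr_gt0// flat0_gt0; lra.
apply/negbTE; rewrite -leNgt le_eqVlt; apply/orP; left.
move: x1; rewrite ler_normr => /orP[h|h]; rewrite /bump mulf_eq0; apply/orP.
  by right; rewrite eq_le flat0_ge0 leNgt flat0_gt0 andbT; lra.
by left; rewrite eq_le flat0_ge0 leNgt flat0_gt0 andbT; lra.
Qed.

Lemma bump_eq0 x : 1 <= `|x| -> bump x = 0.
Proof.
by move=> x1; apply/eqP; rewrite eq_le bump_ge0 andbT leNgt bump_gt0 -leNgt.
Qed.

Local Notation mu := (@lebesgue_measure R).

Lemma bump_continuous : continuous bump.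
Proof. exact/smooth_continuous/smooth_bump. Qed.

Lemma bump_integrable : mu.-integrable setT (EFin \o bump).
Proof.
have E : bump = bump \_ `[-1, 1].
  apply/funext => x; rewrite patchE; case: ifPn => // /negP.
  rewrite inE /= in_itv /= -ler_norml => /negP; rewrite -ltNge => /ltW.
  exact: bump_eq0.
rewrite E -restrict_EFin; apply/integrable_restrict => //.
rewrite setTI; apply: continuous_compact_integrable; first exact: segment_compact.
exact/continuous_subspaceT/bump_continuous.
Qed.

(** The primitive of [bump], a smooth step: 0 to the left of -1 and constant to the
    right of 1. *)
Definition bump_prim (x : R) : R := \int[mu]_(t in `]-oo, x]) bump t.

Lemma bump_prim_derive (x : R) : is_derive x 1 bump_prim (bump x).
Proof.
have i : mu.-integrable `]-oo, x + 1] (EFin \o bump).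
  exact: integrableS bump_integrable.
have [] := @continuous_FTC1 R bump -oo%O x (x + 1) _ i _ (@bump_continuous x).
- by rewrite ltrDl.
- exact: ltNyr.
- by move=> d e; apply: DeriveDef; rewrite -?derive1E.
Qed.

Lemma smooth_bump_prim : smooth_fun bump_prim.
Proof. exact: smooth_primitive bump_prim_derive smooth_bump. Qed.

Lemma bump_prim_left (x : R) : x <= -1 -> bump_prim x = 0.
Proof.
move=> x1; rewrite /bump_prim (@eq_Rintegral _ _ _ _ _ (cst 0)).
  by rewrite /Rintegral integral0.
move=> t; rewrite inE /= in_itv/= => tx; apply: bump_eq0.
by rewrite ler_normr; apply/orP; right; lra.
Qed.

Lemma bump_prim_MVT (x y : R) : x < y ->
  exists2 c, c \in `]x, y[ & bump_prim y - bump_prim x = bump c * (y - x).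
Proof.
move=> xy; apply: MVT => // [z _|]; first exact: bump_prim_derive.
exact/continuous_subspaceT/smooth_continuous/smooth_bump_prim.
Qed.

Lemma bump_prim_right (x : R) : 1 <= x -> bump_prim x = bump_prim 1.
Proof.
rewrite le_eqVlt => /predU1P[->//|x1].
have [c /[!in_itv]/= /andP[c1 _]] := bump_prim_MVT x1.
by rewrite bump_eq0 ?ler_normr ?(ltW c1)// mul0r => /eqP; rewrite subr_eq0 => /eqP.
Qed.

Lemma bump_prim_mono : {homo bump_prim : x y / x <= y}.
Proof.
move=> x y; rewrite le_eqVlt => /predU1P[->//|xy].
have [c _ E] := bump_prim_MVT xy.
by rewrite -subr_ge0 E mulr_ge0 ?bump_ge0// subr_ge0 ltW.
Qed.

Lemma bump_prim_gt0 : 0 < bump_prim 1.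
Proof.
have xy : -1 < 1 :> R by lra.
have [c /[!in_itv]/= c1 E] := bump_prim_MVT xy.
rewrite (bump_prim_left (lexx _)) subr0 in E.
by rewrite E mulr_gt0 ?bump_gt0 ?ltr_norml//; lra.
Qed.

End Bump.

(** * Square integrable functions *)

Section IntegrableEFin.
Context d (T : measurableType d) (R : realType) (mu : {measure set T -> \bar R}).

Lemma integrableZ_EFin (D : set T) (a : R) (f : T -> R) : measurable D ->
  mu.-integrable D (EFin \o f) -> mu.-integrable D (EFin \o (fun x => a * f x)).
Proof. by move=> mD i; have := integrableZl mD a i. Qed.

Lemma integrableD_EFin (D : set T) (f g : T -> R) : measurable D ->
  mu.-integrable D (EFin \o f) -> mu.-integrable D (EFin \o g) ->
  mu.-integrable D (EFin \o (fun x => f x + g x)).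
Proof. by move=> mD i j; have := integrableD mD i j. Qed.

Lemma integrableB_EFin (D : set T) (f g : T -> R) : measurable D ->
  mu.-integrable D (EFin \o f) -> mu.-integrable D (EFin \o g) ->
  mu.-integrable D (EFin \o (fun x => f x - g x)).
Proof. by move=> mD i j; have := integrableB mD i j. Qed.

End IntegrableEFin.

Section SquareIntegrable.
Variable R : realType.
Implicit Types f g : R -> R.
Local Notation mu := (@lebesgue_measure R).
Local Notation L2 f := (f \in Lfun mu 2%:E).

Lemma Lfun2P f : L2 f <->
  measurable_fun setT f /\ mu.-integrable setT (EFin \o (fun x => f x ^+ 2)).
Proof.
split=> [fL|[mf fi]].
  split; last exact: Lfun2_integrable_sqr.
  by move: fL; rewrite inE => /andP[]; rewrite inE.
rewrite inE; apply/andP; split; rewrite inE//=.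
rewrite /finite_norm unlock /=; apply: poweR_lty.
move: fi => /integrableP[_]; apply: le_lt_trans; rewrite le_eqVlt; apply/orP; left; apply/eqP.
apply: eq_integral => x _ /=; rewrite powR_mulrn// real_normK ?num_real//.
by rewrite ger0_norm ?sqr_ge0.
Qed.

Lemma Lfun2_measurable f : L2 f -> measurable_fun setT f.
Proof. by move=> /Lfun2P[]. Qed.

Lemma Lfun2_lin (a : R) f g : L2 f -> L2 g -> L2 (fun x => a * f x + g x).
Proof.
by move=> fL gL; have [_ cl] := Lfun_submod_closed mu (lee1n 2 : (1 <= 2%:E :> \bar R)%E); exact: cl.
Qed.

Lemma Lfun2_le f g : measurable_fun setT f -> L2 g ->
  (forall x, `|f x| <= `|g x|) -> L2 f.
Proof.
move=> mf /Lfun2P[mg gi] fg; apply/Lfun2P; split => //.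
apply: (le_integrable measurableT _ _ gi).
  by apply/measurable_EFinP; exact: measurable_funX.
move=> x _ /=; rewrite lee_fin !normrX.
by rewrite lerXn2r ?nnegrE.
Qed.

Lemma Lfun2Z (a : R) f : L2 f -> L2 (fun x => a * f x).
Proof.
move=> fL; have [cl0 _] := Lfun_submod_closed mu (lee1n 2 : (1 <= 2%:E :> \bar R)%E).
rewrite (_ : (fun _ => _) = (fun x => a * f x + (0 : R -> R) x)); first exact: Lfun2_lin.
by apply/funext => x; rewrite addr0.
Qed.

Lemma Lfun2_bounded (M : R) f g : measurable_fun setT f -> (forall x, `|f x| <= M) ->
  L2 g -> L2 (fun x => f x * g x).
Proof.
move=> mf fM gL; apply: (@Lfun2_le _ (fun x => M * g x)); last first.
- move=> x; rewrite !normrM ler_wpM2r//.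
  by rewrite (le_trans (fM x))// ler_norm.
- exact: Lfun2Z.
- by apply: measurable_funM => //; exact: Lfun2_measurable.
Qed.

Lemma Lfun2M_integrable f g : L2 f -> L2 g ->
  mu.-integrable setT (EFin \o (fun x => f x * g x)).
Proof. exact: integrable_Lfun2. Qed.

(** The L^2 norm. *)
Definition L2norm f : R := Num.sqrt (\int[mu]_x (f x ^+ 2)).

Lemma L2norm_ge0 f : 0 <= L2norm f. Proof. exact: sqrtr_ge0. Qed.

Lemma L2_cauchy_schwarz f g : L2 f -> L2 g ->
  `|\int[mu]_x (f x * g x)| <= L2norm f * L2norm g.
Proof.
move=> fL gL.
set a := \int[mu]_x (f x ^+ 2); set b := \int[mu]_x (f x * g x).
set c := \int[mu]_x (g x ^+ 2).
have a0 : 0 <= a by apply: Rintegral_ge0 => x _; exact: sqr_ge0.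
have c0 : 0 <= c by apply: Rintegral_ge0 => x _; exact: sqr_ge0.
have iff := Lfun2_integrable_sqr fL; have igg := Lfun2_integrable_sqr gL.
have ifg := Lfun2M_integrable fL gL.
have q (s t : R) : 0 <= s ^+ 2 * a + 2 * s * t * b + t ^+ 2 * c.
  have i1 := integrableZ_EFin (s ^+ 2) measurableT iff.
  have i2 := integrableZ_EFin (2 * s * t) measurableT ifg.
  have i3 := integrableZ_EFin (t ^+ 2) measurableT igg.
  rewrite -!RintegralZl// -!RintegralD//; last exact: integrableD_EFin.
  apply: Rintegral_ge0 => x _.
  rewrite (_ : _ + _ = (s * f x + t * g x) ^+ 2) ?sqr_ge0//; ring.
(* The quadratic form [q] is nonnegative; evaluate it at (c, - b), and if c = 0 at a
   point where it would be -1 for b nonzero. *)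
have h : b ^+ 2 <= a * c.
  have [cz|cn] := eqVneq c 0; last first.
    have := q c (- b).
    rewrite (_ : _ + _ = c * (a * c - b ^+ 2)); last by ring.
    by rewrite pmulr_rge0 ?subr_ge0// lt_def cn c0.
  rewrite cz mulr0; have [->|b0] := eqVneq b 0; first by rewrite expr0n.
  have := q 1 (- (a + 1) / (2 * b)); rewrite cz mulr0 addr0.
  by rewrite (_ : _ + _ = -1) ?oppr_ge0 ?ler10//; field.
rewrite -sqrtrM// -sqrtr_sqr; exact: ler_wsqrtr.
Qed.

Lemma L2_cauchy_schwarz_abs f g : L2 f -> L2 g ->
  \int[mu]_x (`|f x| * `|g x|) <= L2norm f * L2norm g.
Proof.
have L2abs h : L2 h -> L2 (fun x => `|h x|).
  move=> hL; apply: (Lfun2_le _ hL) => [|x]; last by rewrite normr_id.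
  by apply: measurableT_comp => //; exact: Lfun2_measurable.
have nabs h : L2norm (fun x => `|h x|) = L2norm h.
  by congr Num.sqrt; apply: eq_Rintegral => x _; rewrite real_normK ?num_real.
move=> fL gL; rewrite -nabs -(nabs g); apply: le_trans (ler_norm _) _.
by apply: L2_cauchy_schwarz; exact: L2abs.
Qed.

Lemma L2_compact_bound (K c d : R) f : c <= d -> continuous f -> 0 <= K ->
  (forall x, `|f x| <= K) -> (forall x, ~~ (c <= x <= d) -> f x = 0) ->
  L2 f /\ L2norm f <= Num.sqrt (d - c) * K.
Proof.
move=> cd cf K0 fK f0; split.
  apply: (compact_Lfun2 cf (@segment_compact _ c d)) => x h.
  by apply: f0; apply/negP => h'; apply: h; rewrite /= in_itv.
rewrite -[X in _ * X](ger0_norm K0) -sqrtr_sqr -sqrtrM ?subr_ge0//.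
apply: ler_wsqrtr.
have E : (fun x => f x ^+ 2) = (fun x => f x ^+ 2) \_ `[c, d].
  apply/funext => x; rewrite patchE; case: ifPn => //.
  by move=> /negP h; rewrite f0 ?expr0n//; apply/negP => h'; apply: h; rewrite inE/= in_itv.
rewrite E -Rintegral_mkcond.
have -> : (d - c) * K ^+ 2 = \int[mu]_(x in `[c, d]) (K ^+ 2).
  rewrite Rintegral_cst//= lebesgue_measure_itv/= lte_fin.
  case: ltP => [_|dc]; first by rewrite mulrC -EFinD.
  by rewrite (_ : d - c = 0) ?mulr0 ?mul0r//; apply/eqP; rewrite subr_eq0 eq_le dc cd.
apply: le_Rintegral => //.
- apply: continuous_compact_integrable; first exact: segment_compact.
  apply: continuous_subspaceT => x; rewrite (_ : (fun _ => _) = f \* f)//; apply: continuousM; exact: cf.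
- apply: continuous_compact_integrable; first exact: segment_compact.
  by apply: continuous_subspaceT => x; exact: cst_continuous.
- by move=> x _; rewrite -real_normK ?num_real// lerXn2r ?nnegrE.
Qed.

End SquareIntegrable.

(** * The Sobolev embedding *)

Section SobolevEmbedding.
Variable R : realType.
Implicit Types (f u g : R -> R) (x d t : R).
Local Notation mu := (@lebesgue_measure R).
Local Notation L2 f := (f \in Lfun mu 2%:E).
Local Notation c := (@bump_prim R 1).

(** The bump of width [d] > 0 centred at [x], with an integral that does not depend
    on [d], and its primitive. *)
Definition bump_at x d (t : R) : R := d^-1 * bump (d^-1 * t + - (d^-1 * x)).
Definition step_at x d (t : R) : R := bump_prim (d^-1 * t + - (d^-1 * x)).

Lemma bump_prim_bound (t : R) : 0 <= bump_prim t <= c.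
Proof.
have [t1|t1] := lerP t (-1).
  by rewrite bump_prim_left// lexx ltW// bump_prim_gt0.
have [t2|/ltW t2] := lerP t 1.
  rewrite (bump_prim_mono t2) andbT -(bump_prim_left (lexx (-1))).
  exact/bump_prim_mono/ltW.
by rewrite bump_prim_right// lexx andbT ltW// bump_prim_gt0.
Qed.

Lemma step_at_derive x d t : is_derive t 1 (step_at x d) (bump_at x d t).
Proof. by apply: is_derive_affine; exact: bump_prim_derive. Qed.

Lemma smooth_bump_at x d : smooth_fun (bump_at x d).
Proof.
have s : smooth_fun (cst d^-1 * (fun t => @bump R (d^-1 * t + - (d^-1 * x)))).
  by apply: smoothM; [exact: smooth_cst|apply: smooth_affine; exact: smooth_bump].
exact: s.
Qed.

Lemma bump_at_continuous x d : continuous (bump_at x d).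
Proof. exact/smooth_continuous/smooth_bump_at. Qed.

Lemma bump_at_ge0 x d t : 0 < d -> 0 <= bump_at x d t.
Proof. by move=> d0; rewrite mulr_ge0 ?bump_ge0// invr_ge0 ltW. Qed.

Lemma step_at_smooth x d : smooth_fun (step_at x d).
Proof. by apply: smooth_affine; exact: smooth_bump_prim. Qed.

Let affineE x d t : d^-1 * t + - (d^-1 * x) = (t - x) / d.
Proof. by ring. Qed.

Lemma bump_at_bound x d t : 0 < d -> `|bump_at x d t| <= d^-1.
Proof.
move=> d0; have dV : 0 <= d^-1 by rewrite invr_ge0 ltW.
by rewrite /bump_at normrM (ger0_norm (bump_ge0 _)) (ger0_norm dV) ler_piMr ?bump_le1.
Qed.

Lemma bump_at_out x d t : 0 < d -> d <= `|t - x| -> bump_at x d t = 0.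
Proof.
move=> d0 h; rewrite /bump_at affineE bump_eq0 ?mulr0//.
by rewrite normrM normfV (gtr0_norm d0) ler_pdivlMr// mul1r.
Qed.

Lemma step_at_left x d t : 0 < d -> t <= x - d -> step_at x d t = 0.
Proof.
move=> d0 h; rewrite /step_at affineE bump_prim_left//.
by rewrite ler_pdivrMr//; lra.
Qed.

Lemma step_at_right x d t : 0 < d -> x + d <= t -> step_at x d t = c.
Proof.
move=> d0 h; rewrite /step_at affineE bump_prim_right//.
by rewrite ler_pdivlMr//; lra.
Qed.

Lemma bump_at_L2 x d : 0 < d -> d <= 1 ->
  L2 (bump_at x d) /\ L2norm (bump_at x d) <= Num.sqrt 2 * d^-1.
Proof.
move=> d0 d1; rewrite -[X in Num.sqrt X](_ : (x + 1) - (x - 1) = 2); last by ring.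
apply: L2_compact_bound.
- lra.
- exact: bump_at_continuous.
- by rewrite invr_ge0 ltW.
- by move=> t; exact: bump_at_bound.
- move=> t h; apply: bump_at_out => //; apply: (le_trans d1).
  by move: h; rewrite negb_and -!ltNge ler_normr => /orP[] h; apply/orP; [right|left]; lra.
Qed.

(** A test function with derivative [bump_at x d - bump_at x 1]. *)
Definition cutoff x d t : R := step_at x d t - step_at x 1 t.

Lemma cutoff_derive x d t : is_derive t 1 (cutoff x d) (bump_at x d t - bump_at x 1 t).
Proof. by apply: is_deriveB; exact: step_at_derive. Qed.

Lemma cutoff_smooth x d : smooth_fun (cutoff x d).
Proof.
have -> : cutoff x d = step_at x d + cst (-1) * step_at x 1.
  by apply/funext => t; rewrite !fctE mulN1r.
by apply: smoothD; [|apply: smoothM; first exact: smooth_cst]; exact: step_at_smooth.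
Qed.

Lemma cutoff_out x d t : 0 < d -> d <= 1 -> ~~ (x - 1 <= t <= x + 1) -> cutoff x d t = 0.
Proof.
rewrite /cutoff negb_and -!ltNge => d0 d1 /orP[] h.
  by rewrite !step_at_left// ?subr0//; lra.
by rewrite !step_at_right// ?subrr//; lra.
Qed.

Lemma cutoff_test x d : 0 < d -> d <= 1 -> test_function (cutoff x d).
Proof.
move=> d0 d1; split; first exact: cutoff_smooth.
apply: (@subclosed_compact _ _ `[x - 1, x + 1]).
- exact: closed_closure.
- exact: segment_compact.
- rewrite [X in _ `<=` X](closure_id _).1; last exact: interval_closed.
  apply: closureS => t /= h; rewrite in_itv/=; apply/negPn/negP => h'.
  by move: h; rewrite cutoff_out// eqxx.
Qed.

Lemma cutoff_L2 x d : 0 < d -> d <= 1 ->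
  L2 (cutoff x d) /\ L2norm (cutoff x d) <= Num.sqrt 2 * c.
Proof.
move=> d0 d1; rewrite -[X in Num.sqrt X](_ : (x + 1) - (x - 1) = 2); last by ring.
apply: L2_compact_bound.
- lra.
- exact/smooth_continuous/cutoff_smooth.
- exact/ltW/bump_prim_gt0.
- move=> t; have /andP[a1 a2] := bump_prim_bound (d^-1 * t + - (d^-1 * x)).
  have /andP[b1 b2] := bump_prim_bound (1^-1 * t + - (1^-1 * x)).
  by rewrite ler_norml /cutoff /step_at; apply/andP; split; lra.
- by move=> t; exact: cutoff_out.
Qed.

Lemma bump_at_restrict x d : 0 < d -> d <= 1 ->
  bump_at x d = bump_at x d \_ `[x - 1, x + 1].
Proof.
move=> d0 d1; apply/funext => t; rewrite patchE; case: ifPn => //.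
move=> /negP h; rewrite bump_at_out//; apply: (le_trans d1).
rewrite leNgt; apply/negP => h1; apply: h; rewrite inE/= in_itv/=.
by move: h1; rewrite ltr_norml => /andP[? ?]; apply/andP; split; lra.
Qed.

Lemma bump_at_integral x d : 0 < d -> d <= 1 -> \int[mu]_t bump_at x d t = c.
Proof.
move=> d0 d1.
rewrite (bump_at_restrict x d0 d1).
rewrite -Rintegral_mkcond /Rintegral (@continuous_FTC2 _ _ (step_at x d)).
- by rewrite step_at_right ?step_at_left ?sube0//=; lra.
- lra.
- exact/continuous_subspaceT/bump_at_continuous.
- have sc := smooth_continuous (@step_at_smooth x d).
  split; first by move=> t _; case: (step_at_derive x d t).
    by apply: cvg_at_right_filter; exact: sc.
  by apply: cvg_at_left_filter; exact: sc.
- by move=> t _; rewrite derive1E; case: (step_at_derive x d t).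
Qed.

Lemma bump_at_integrable x d : 0 < d -> d <= 1 ->
  mu.-integrable setT (EFin \o bump_at x d).
Proof.
move=> d0 d1.
rewrite (bump_at_restrict x d0 d1).
rewrite -restrict_EFin; apply/integrable_restrict => //.
rewrite setTI; apply: continuous_compact_integrable; first exact: segment_compact.
exact/continuous_subspaceT/bump_at_continuous.
Qed.

Lemma lebesgue_integrableS (E D : set R) f : measurable E -> measurable D ->
  D `<=` E -> mu.-integrable E (EFin \o f) -> mu.-integrable D (EFin \o f).
Proof. by move=> mE mD DE i; exact: (@integrableS _ _ _ mu E D _ mE mD DE i). Qed.

Lemma Lfun2_compact_integrable u (K : set R) : L2 u -> compact K ->
  mu.-integrable K (EFin \o u).
Proof.
move=> /Lfun2P[mu_ ui] cK; have mK : measurable K by exact: compact_measurable.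
have iK : mu.-integrable K (EFin \o (fun x => 1 + u x ^+ 2)).
  apply: integrableD_EFin => //.
    apply: continuous_compact_integrable => //.
    by apply: continuous_subspaceT => x; exact: cst_continuous.
  exact: integrableS ui.
(* u is dominated by 1 + u ^ 2. *)
apply: (le_integrable _ _ _ iK) => //.
  by apply/measurable_EFinP; apply: measurable_funTS.
move=> x _ /=; rewrite lee_fin [leRHS]ger0_norm ?addr_ge0 ?sqr_ge0//.
rewrite -(@real_normK _ (u x)) ?num_real//.
by have := sqr_ge0 (`|u x| - 2^-1); nra.
Qed.

Lemma Lfun2_locally_integrable u : L2 u -> locally_integrable setT u.
Proof.
move=> uL; split; [exact: Lfun2_measurable|exact: openT|].
by move=> K _ cK; have /integrableP[] := Lfun2_compact_integrable uL cK.
Qed.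

(** Averages of a weakly differentiable function against the bumps centred at [x]
    are bounded uniformly in the width, because the difference of two bumps is the
    derivative of a bounded test function with support in a fixed interval. *)
Lemma bump_average_bound u g x d : L2 u -> L2 g ->
  (forall phi, test_function phi ->
    \int[mu]_t (derive1 phi t * u t) = - \int[mu]_t (phi t * g t)) ->
  0 < d -> d <= 1 ->
  `|\int[mu]_t (bump_at x d t * u t)| <= Num.sqrt 2 * (1 + c) * (L2norm u + L2norm g).
Proof.
move=> uL gL wk d0 d1.
have := wk _ (cutoff_test x d0 d1).
have [bL _] := bump_at_L2 x d0 d1.
have [b1L b1b] := bump_at_L2 x (@ltr01 R) (lexx 1).
have [cL cb] := cutoff_L2 x d0 d1.
rewrite (_ : (fun t => _) = (fun t => bump_at x d t * u t - bump_at x 1 t * u t)); last first.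
  by apply/funext => t; rewrite derive1E; case: (cutoff_derive x d t) => _ ->; rewrite mulrBl.
rewrite RintegralB//; [|exact: Lfun2M_integrable..].
move=> /eqP; rewrite subr_eq => /eqP ->; rewrite addrC.
have h1 := L2_cauchy_schwarz b1L uL.
have h2 := L2_cauchy_schwarz cL gL.
rewrite (le_trans (ler_normB _ _))//.
have c0 := ltW (bump_prim_gt0 R).
have s0 : 0 <= Num.sqrt 2 :> R by exact: sqrtr_ge0.
have u0 := L2norm_ge0 u. have g0 := L2norm_ge0 g.
rewrite (@le_trans _ _ (Num.sqrt 2 * L2norm u + Num.sqrt 2 * c * L2norm g))//.
  apply: lerD; [apply: (le_trans h1)|apply: (le_trans h2)]; rewrite ler_wpM2r//.
  by rewrite (le_trans b1b)// invr1 mulr1.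
have := mulr_ge0 s0 u0; have := mulr_ge0 s0 g0.
move=> p1 p2; have := mulr_ge0 c0 p1; have := mulr_ge0 c0 p2; nra.
Qed.

Lemma fine_davg u x d : 0 < d -> mu.-integrable (ball x d) (EFin \o (fun t => u t - u x)) ->
  fine (davg u x d) = (d *+ 2)^-1 * \int[mu]_(t in ball x d) `|u t - u x|.
Proof.
move=> d0 /integrable_norm ui; rewrite /davg /iavg lebesgue_measure_ball ?ltW//.
rewrite inver mulrn_eq0/= gt_eqF//.
rewrite fineM//; apply: integrable_fin_num ui.
exact: measurable_ball.
Qed.

Lemma bump_average_davg u x d : L2 u -> 0 < d -> d <= 1 ->
  `|\int[mu]_t (bump_at x d t * u t) - c * u x| <= 2 * fine (davg u x d).
Proof.
move=> uL d0 d1.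
have [bL _] := bump_at_L2 x d0 d1.
have ib := bump_at_integrable x d0 d1.
have ibu := Lfun2M_integrable bL uL.
have mball : measurable (ball x d) by exact: measurable_ball.
have iball : mu.-integrable (ball x d) (EFin \o (fun t => u t - u x)).
  have bI : ball x d `<=` `[x - d, x + d] by rewrite ball_itv; exact: subset_itv_oo_cc.
  have cI := @segment_compact R (x - d) (x + d).
  apply: integrableB_EFin => //.
    exact: (lebesgue_integrableS _ mball bI (Lfun2_compact_integrable uL cI)).
  apply: (lebesgue_integrableS _ mball bI) => //.
  apply: continuous_compact_integrable => //.
  by apply: continuous_subspaceT => t; exact: cst_continuous.
have ibx : mu.-integrable setT (EFin \o (fun t => bump_at x d t * u x)).
  rewrite (_ : (fun t => _) = (fun t => u x * bump_at x d t)); first exact: integrableZ_EFin.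
  by apply/funext => t; rewrite mulrC.
have ibb := integrableB_EFin measurableT ibu ibx.
rewrite (_ : 2 * _ = \int[mu]_(t in ball x d) (d^-1 * `|u t - u x|)); last first.
  rewrite RintegralZl//; last exact: integrable_norm iball.
  by rewrite (fine_davg d0 iball) mulrA; congr (_ * _); field; rewrite gt_eqF.
rewrite -(bump_at_integral x d0 d1) -RintegralZr// -RintegralB//.
apply: le_trans (le_normr_Rintegral _ _) _ => //.
rewrite [leLHS](_ : _ = \int[mu]_(t in ball x d) `|bump_at x d t * u t - bump_at x d t * u x|); last first.
  rewrite [RHS]Rintegral_mkcond; apply: eq_Rintegral => t _; rewrite patchE.
  case: ifPn => // /negP h; rewrite bump_at_out ?mul0r ?subrr ?normr0//.
  rewrite leNgt; apply/negP => td; apply: h.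
  by rewrite inE /ball/= distrC.
apply: le_Rintegral => //.
- by apply: integrable_norm; exact: integrableS ibb.
- by apply: integrableZ_EFin => //; exact: integrable_norm iball.
- move=> t _; rewrite -mulrBr normrM ler_wpM2r// bump_at_bound//.
Qed.

(** At a Lebesgue point [x], the integrals of [u] against the bumps shrinking to [x]
    tend to [c * u x]. *)
Lemma lebesgue_pt_bound u g x : L2 u -> L2 g ->
  (forall phi, test_function phi ->
    \int[mu]_t (derive1 phi t * u t) = - \int[mu]_t (phi t * g t)) ->
  lebesgue_pt u x ->
  c * `|u x| <= Num.sqrt 2 * (1 + c) * (L2norm u + L2norm g).
Proof.
move=> uL gL wk /fine_cvgP[_ lx]; apply/ler_addgt0Pr => e e0.
have c0 := bump_prim_gt0 R.
have e2 : 0 < e / 2 by rewrite divr_gt0.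
have H : \forall d \near 0^'+, fine (davg u x d) < e / 2 by exact: (cvgr_lt _ lx).
near (0 : R)^'+ => d.
have dd : fine (davg u x d) < e / 2 by near: d.
have d0 : 0 < d by near: d; exact: nbhs_right_gt.
have d1 : d <= 1 by near: d; exact: nbhs_right_le.
have h1 := bump_average_bound x uL gL wk d0 d1.
have h2 := bump_average_davg x uL d0 d1.
rewrite -(ger0_norm (ltW c0)) -normrM (ger0_norm (ltW c0)).
set I := \int[mu]_t _ in h1 h2.
have -> : c * u x = I - (I - c * u x) by ring.
rewrite (le_trans (ler_normB _ _))// lerD//.
by apply: (le_trans h2); lra.
Unshelve. all: by end_near.
Qed.

(** The Sobolev embedding of H^1 into L^oo: [M] does not depend on [u], and [g] is
    the weak derivative of [u]. *)
Theorem sobolev_bound : exists2 M : R, 0 <= M & forall u g, L2 u -> L2 g ->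
  (forall phi, test_function phi ->
    \int[mu]_t (derive1 phi t * u t) = - \int[mu]_t (phi t * g t)) ->
  {ae mu, forall x, `|u x| <= M * (L2norm u + L2norm g)}.
Proof.
have c0 := bump_prim_gt0 R.
exists (Num.sqrt 2 * (1 + c) / c).
  by rewrite divr_ge0 ?mulr_ge0 ?sqrtr_ge0 ?addr_ge0// ltW.
move=> u g uL gL wk.
have := lebesgue_differentiation (Lfun2_locally_integrable uL).
apply: (@filterS _ _ (ae_filter_ringOfSetsType mu)) => x /(lebesgue_pt_bound uL gL wk).
by rewrite mulrC -ler_pdivlMr// -!mulrA [c^-1 * _]mulrC.
Qed.

End SobolevEmbedding.

(** * Pointwise estimates for powers of the modulus *)

Section PowerInequalities.
Variable R : realType.
Implicit Types (a b c d x y q s M : R).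

(** The tangent line inequality for the convex function y ^ q. *)
Lemma powR_tangent q x y : 1 < q -> 0 <= x -> 0 <= y ->
  x `^ q + q * x `^ (q - 1) * (y - x) <= y `^ q.
Proof.
move=> q1 x0 y0; have q0 : 0 < q by lra.
have qn0 : q != 0 by rewrite gt_eqF.
have qn1 : q - 1 != 0 by rewrite gt_eqF//; lra.
have q'0 : 0 < q / (q - 1) by rewrite divr_gt0//; lra.
have xq : x `^ (q - 1) * x = x `^ q by rewrite mulrC mulr_powRB1.
(* Young's inequality for y and x ^ (q - 1), with the conjugate exponents q and
   q / (q - 1). *)
have := conjugate_powR y0 (powR_ge0 x (q - 1)) q0 q'0.
rewrite -powRrM (_ : (q - 1) * _ = q); last by field; rewrite ?qn0 ?qn1//.
rewrite invf_div => /(_ _)/wrap[]; first by field; rewrite ?qn0 ?qn1//.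
rewrite -(ler_pM2l q0) => h.
have {}h : q * (y * x `^ (q - 1)) <= y `^ q + (q - 1) * x `^ q.
  apply: (le_trans h); rewrite le_eqVlt; apply/orP; left; apply/eqP; field; rewrite ?qn0 ?qn1//.
have := congr1 (fun z => q * z) xq => /= xq'; lra.
Qed.

(** The power y ^ s need not be Lipschitz at 0 when s < 1; the factor [x]
    compensates for this. *)
Lemma powR_diff_bound s x y M : 0 < s -> 0 <= x -> 0 <= y -> x <= M -> y <= M ->
  x * `|y `^ s - x `^ s| <= (1 + s) * M `^ s * `|y - x|.
Proof.
move=> s0 x0 y0 xM yM.
have s1 : 1 < s + 1 by lra.
have xs : x * x `^ s = x `^ (s + 1) by rewrite -[s in LHS](addrK 1) mulr_powRB1//; lra.
have ys : y * y `^ s = y `^ (s + 1) by rewrite -[s in LHS](addrK 1) mulr_powRB1//; lra.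
have pw z : 0 <= z -> z <= M -> z `^ s <= M `^ s.
  by move=> z0 zM; rewrite ge0_ler_powR ?nnegrE ?(ltW s0)//; exact: le_trans zM.
have [xy|/ltW yx] := lerP x y.
- rewrite ger0_norm; last by rewrite subr_ge0 ge0_ler_powR ?nnegrE// ltW.
  have := powR_tangent s1 y0 x0; rewrite addrK => h.
  have y1 : 0 <= y `^ s * (y - x) by rewrite mulr_ge0 ?powR_ge0// subr_ge0.
  apply: (@le_trans _ _ ((1 + s) * y `^ s * (y - x))); first lra.
  by rewrite ler_wpM2r ?subr_ge0// ler_wpM2l ?pw//; lra.
- rewrite ler0_norm; last by rewrite subr_le0 ge0_ler_powR ?nnegrE// ltW.
  rewrite opprB.
  have := powR_tangent s1 x0 y0; rewrite addrK => h.
  have y1 : 0 <= y `^ s * (x - y) by rewrite mulr_ge0 ?powR_ge0// subr_ge0.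
  apply: (@le_trans _ _ ((1 + s) * x `^ s * (x - y))); first lra.
  by rewrite ler_wpM2r ?subr_ge0// ler_wpM2l ?pw//; lra.
Qed.

(** The Euclidean norm of the plane. *)
Definition norm2 a b : R := Num.sqrt (a ^+ 2 + b ^+ 2).

Lemma norm2_ge0 a b : 0 <= norm2 a b. Proof. exact: sqrtr_ge0. Qed.

Lemma norm2_sqr a b : norm2 a b ^+ 2 = a ^+ 2 + b ^+ 2.
Proof. by rewrite sqr_sqrtr// addr_ge0 ?sqr_ge0. Qed.

Lemma norm2_l a b : `|a| <= norm2 a b.
Proof. by rewrite -sqrtr_sqr ler_wsqrtr// lerDl sqr_ge0. Qed.

Lemma norm2_r a b : `|b| <= norm2 a b.
Proof. by rewrite -sqrtr_sqr ler_wsqrtr// lerDr sqr_ge0. Qed.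

Lemma norm2_dot a b c d : a * c + b * d <= norm2 a b * norm2 c d.
Proof.
apply: le_trans (ler_norm _) _; rewrite -sqrtr_sqr -sqrtrM ?addr_ge0 ?sqr_ge0//.
by apply: ler_wsqrtr; have := sqr_ge0 (a * d - b * c); nra.
Qed.

Lemma norm2_le a b c d : norm2 c d <= norm2 a b + norm2 (c - a) (d - b).
Proof.
have [x0 h0] := (norm2_ge0 a b, norm2_ge0 (c - a) (d - b)).
rewrite -ler_sqr ?nnegrE ?norm2_ge0 ?addr_ge0// sqrrD !norm2_sqr.
by have := norm2_dot a b (c - a) (d - b); lra.
Qed.

Lemma norm2_dist a b c d : `|norm2 c d - norm2 a b| <= norm2 (c - a) (d - b).
Proof.
have h := norm2_le a b c d; have h' := norm2_le c d a b.
have E : norm2 (a - c) (b - d) = norm2 (c - a) (d - b).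
  by congr Num.sqrt; ring.
by rewrite E in h'; rewrite ler_norml; apply/andP; split; lra.
Qed.

(** The vector field |z| ^ s z of the plane is locally Lipschitz; this is its first
    component. *)
Lemma powR_field_lip s M a b c d : 0 < s -> norm2 a b <= M -> norm2 c d <= M ->
  `|norm2 c d `^ s * c - norm2 a b `^ s * a| <= (2 + s) * M `^ s * norm2 (c - a) (d - b).
Proof.
move=> s0 xM yM; set x := norm2 a b in xM *; set y := norm2 c d in yM *.
set h := norm2 _ _.
have x0 : 0 <= x by exact: norm2_ge0.
have y0 : 0 <= y by exact: norm2_ge0.
have h0 : 0 <= h by exact: norm2_ge0.
have M0 : 0 <= M by exact: le_trans xM.
have yMs : y `^ s <= M `^ s by rewrite ge0_ler_powR ?nnegrE ?(ltW s0).
have -> : y `^ s * c - x `^ s * a = y `^ s * (c - a) + (y `^ s - x `^ s) * a by ring.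
apply: le_trans (ler_normD _ _) _.
have -> : (2 + s) * M `^ s * h = M `^ s * h + (1 + s) * M `^ s * h by ring.
apply: lerD; rewrite normrM.
  by rewrite ger0_norm ?powR_ge0// ler_pM ?powR_ge0//; exact: norm2_l.
apply: (@le_trans _ _ (x * `|y `^ s - x `^ s|)).
  by rewrite mulrC ler_wpM2r//; exact: norm2_l.
apply: le_trans (powR_diff_bound s0 x0 y0 xM yM) _.
rewrite ler_wpM2l ?norm2_dist// mulr_ge0 ?powR_ge0//; lra.
Qed.

Lemma norm2C a b : norm2 a b = norm2 b a.
Proof. by rewrite /norm2 addrC. Qed.

Lemma powR_field_lip_r s M a b c d : 0 < s -> norm2 a b <= M -> norm2 c d <= M ->
  `|norm2 c d `^ s * d - norm2 a b `^ s * b| <= (2 + s) * M `^ s * norm2 (c - a) (d - b).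
Proof.
by rewrite (norm2C a) (norm2C c) (norm2C (c - a)); exact: powR_field_lip.
Qed.

(** The remainder of the first order expansion of |z| ^ (s + 2) is quadratic:
    convexity bounds it from below by 0, and, with the roles of the two points
    exchanged, from above by the variation of the gradient. *)
Lemma powR_taylor s M a b c d : 0 < s -> norm2 a b <= M -> norm2 c d <= M ->
  `|norm2 c d `^ (s + 2) - norm2 a b `^ (s + 2) -
    (s + 2) * norm2 a b `^ s * (a * (c - a) + b * (d - b))| <=
  2 * (s + 2) * ((2 + s) * M `^ s) * norm2 (c - a) (d - b) ^+ 2.
Proof.
move=> s0 xM yM.
have tg (a' b' c' d' : R) : norm2 a' b' `^ (s + 2) +
    (s + 2) * norm2 a' b' `^ s * (a' * (c' - a') + b' * (d' - b')) <=
    norm2 c' d' `^ (s + 2).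
  set x := norm2 a' b'; set y := norm2 c' d'.
  have x0 : 0 <= x by exact: norm2_ge0.
  have s2 : 1 < s + 2 by lra.
  apply: le_trans (powR_tangent s2 x0 (norm2_ge0 c' d')).
  rewrite lerD2l -!mulrA ler_pM2l; last lra.
  have -> : x `^ (s + 2 - 1) = x `^ s * x.
    rewrite mulrC -[s in RHS](_ : s + 2 - 1 - 1 = s) ?mulr_powRB1//; lra.
  rewrite -mulrA ler_wpM2l ?powR_ge0//.
  have := norm2_dot a' b' c' d'; rewrite -/x -/y.
  have : x ^+ 2 = a' ^+ 2 + b' ^+ 2 by exact: norm2_sqr.
  nra.
have t1 := tg a b c d; have t2 := tg c d a b.
have l1 := powR_field_lip s0 xM yM.
have l2 := powR_field_lip_r s0 xM yM.
set K := (2 + s) * M `^ s in l1 l2 *; set h := norm2 (c - a) (d - b) in l1 l2 *.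
have h0 : 0 <= h by exact: norm2_ge0.
rewrite ger0_norm; last lra.
set X := norm2 c d `^ s * c - norm2 a b `^ s * a in l1.
set Y := norm2 c d `^ s * d - norm2 a b `^ s * b in l2.
apply: (@le_trans _ _ ((s + 2) * (X * (c - a) + Y * (d - b)))).
  rewrite /X /Y; lra.
rewrite -!mulrA [leRHS]mulrCA ler_pM2l; last lra.
have K0 : 0 <= K * h by exact: le_trans l1.
have e1 : X * (c - a) <= K * h * h.
  apply: le_trans (ler_norm _) _; rewrite normrM ler_pM//; exact: norm2_l.
have e2 : Y * (d - b) <= K * h * h.
  apply: le_trans (ler_norm _) _; rewrite normrM ler_pM//; exact: norm2_r.
rewrite (_ : 2 * _ = K * h * h + K * h * h); last by rewrite /K; ring.
exact: lerD.
Qed.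

End PowerInequalities.

(** * Coordinates on H^1 *)

Section Coordinates.
Local Open Scope quotient_scope.
Variable R : realType.
Local Notation mu := (@lebesgue_measure R).
Local Notation L2 f := (f \in Lfun mu 2%:E).
Local Notation V := (H1 R).
Implicit Types (u v w : V) (f g h : nat -> R -> R) (z : nat -> R).

(** The real coordinates of an element of H^1: real and imaginary part of the
    function, then of its derivative. All indices from 3 on denote the last one. *)
Definition coord u (i : nat) (x : R) : R :=
  match i with
  | 0 => complex.Re (h1_fun u x)
  | 1 => complex.Im (h1_fun u x)
  | 2 => complex.Re (h1_deriv u x)
  | _ => complex.Im (h1_deriv u x)
  end.

Lemma reprP u : weak_pair_val (repr u) \in @sobolev_graph R.
Proof. by case: (repr u). Qed.

Lemma coord_L2 u i : L2 (coord u i).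
Proof.
have /asboolP[[a b] [c d] _] := reprP u.
by case: i => [|[|[|]]].
Qed.

Lemma coord_weak u i phi : (i < 2)%N -> test_function phi ->
  \int[mu]_x (derive1 phi x * coord u i x) = - \int[mu]_x (phi x * coord u i.+2 x).
Proof.
move=> i2 tphi; have /asboolP[_ _ /(_ _ tphi) h] := reprP u.
case: i i2 => [|[|//]] _.
  have /= := congr1 (@complex.Re R) h; rewrite /cintegral/=.
  move=> E; rewrite [LHS](_ : _ = \int[mu]_x complex.Re (phi^`()%classic x *: (repr u).1 x : Rcomplex R)).
    rewrite E; congr (- _).
    by apply: eq_Rintegral => x _ /=; rewrite /h1_deriv; case: ((repr u).2 x).
  by apply: eq_Rintegral => x _ /=; rewrite /h1_fun; case: ((repr u).1 x).
have /= := congr1 (@complex.Im R) h; rewrite /cintegral/=.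
move=> E; rewrite [LHS](_ : _ = \int[mu]_x complex.Im (phi^`()%classic x *: (repr u).1 x : Rcomplex R)).
  rewrite E; congr (- _).
  by apply: eq_Rintegral => x _ /=; rewrite /h1_deriv; case: ((repr u).2 x).
by apply: eq_Rintegral => x _ /=; rewrite /h1_fun; case: ((repr u).1 x).
Qed.

Lemma h1_normE u : `|u| ^+ 2 = \int[mu]_x (coord u 0 x ^+ 2 + coord u 1 x ^+ 2 +
  (coord u 2 x ^+ 2 + coord u 3 x ^+ 2)).
Proof.
rewrite [LHS]sqr_sqrtr ?h1_inner_ge0//; apply: eq_Rintegral => x _ /=.
by case: (h1_fun u x) (h1_deriv u x) => [a b] [c d] /=; ring.
Qed.

Lemma coord_lin (a : R) u v : {ae mu, forall x, forall i,
  coord (a *: u + v) i x = a * coord u i x + coord v i x}.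
Proof.
have -> : a *: u + v = \pi_(H1 R) (a *: repr u + repr v).
  rewrite -[in LHS](reprK v) -[a *: u]/(h1_scale a u) -{1}(reprK u).
  by rewrite (pi_scale a (repr u)) pi_H1D.
set z := _ + _; have /asboolP := repr_pi_H1 z.
apply: (@filterS _ _ (ae_filter_ringOfSetsType mu)) => x [e1 e2] i.
have {}e1 : h1_fun (\pi_(H1 R) z) x = a *: (repr u).1 x + (repr v).1 x.
  by apply/eqP; rewrite -subr_eq0; apply/eqP; exact: e1.
have {}e2 : h1_deriv (\pi_(H1 R) z) x = a *: (repr u).2 x + (repr v).2 x.
  by apply/eqP; rewrite -subr_eq0; apply/eqP; exact: e2.
rewrite /coord e1 e2 /h1_fun /h1_deriv.
case: ((repr u).1 x) ((repr u).2 x) ((repr v).1 x) ((repr v).2 x) => [? ?] [? ?] [? ?] [? ?].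
by case: i => [|[|[|]]].
Qed.

(** [f] is a family of square integrable functions equal almost everywhere to the
    coordinates of [u]. Integral functionals can be computed on any such family, and
    contrary to [coord] such families can be combined linearly and chosen bounded. *)
Definition represents u f : Prop :=
  (forall i, L2 (f i)) /\ {ae mu, forall x, forall i, coord u i x = f i x}.

Lemma coord_represents u : represents u (coord u).
Proof. by split; [exact: coord_L2|apply: aeW]. Qed.

Lemma represents_lin (a : R) u v f g : represents u f -> represents v g ->
  represents (a *: u + v) (fun i x => a * f i x + g i x).
Proof.
move=> [fL uf] [gL vg]; split=> [i|]; first exact: Lfun2_lin.
move: uf vg (coord_lin a u v).
apply: (@filterS3 _ _ (ae_filter_ringOfSetsType mu)) => x uf vg E i.
by rewrite E uf vg.
Qed.

Lemma represents_integral (D : (nat -> R) -> R) u f : represents u f ->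
  (forall f, (forall i, L2 (f i)) -> measurable_fun setT (fun x => D (f^~ x))) ->
  \int[mu]_x D (coord u ^~ x) = \int[mu]_x D (f^~ x).
Proof.
move=> [fL uf] mD; rewrite /Rintegral; congr fine; apply: ae_eq_integral => //.
- by apply/measurable_EFinP; apply: mD => i; exact: coord_L2.
- by apply/measurable_EFinP; exact: mD.
- move: uf; apply: (@filterS _ _ (ae_filter_ringOfSetsType mu)) => x uf _.
  by congr (D _)%:E; apply/funext.
Qed.

Lemma represents_integral2 (D : (nat -> R) -> (nat -> R) -> R) u v f g :
  represents u f -> represents v g ->
  (forall f g, (forall i, L2 (f i)) -> (forall i, L2 (g i)) ->
    measurable_fun setT (fun x => D (f^~ x) (g^~ x))) ->
  \int[mu]_x D (coord u ^~ x) (coord v ^~ x) = \int[mu]_x D (f^~ x) (g^~ x).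
Proof.
move=> [fL uf] [gL vg] mD; rewrite /Rintegral; congr fine; apply: ae_eq_integral => //.
- by apply/measurable_EFinP; apply: mD => i; exact: coord_L2.
- by apply/measurable_EFinP; exact: mD.
- move: uf vg; apply: (@filterS2 _ _ (ae_filter_ringOfSetsType mu)) => x uf vg _.
  by congr (D _ _)%:E; apply/funext.
Qed.

Lemma represents_norm u f : represents u f ->
  `|u| ^+ 2 = \int[mu]_x (f 0 x ^+ 2 + f 1 x ^+ 2 + (f 2 x ^+ 2 + f 3 x ^+ 2)).
Proof.
move=> uf; rewrite h1_normE.
apply: (represents_integral (D := fun z => z 0 ^+ 2 + z 1 ^+ 2 + (z 2 ^+ 2 + z 3 ^+ 2)) uf).
move=> g gL; have mg i : measurable_fun setT (g i) by exact: Lfun2_measurable.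
by repeat apply: measurable_funD; apply: measurable_funX.
Qed.

End Coordinates.

(** * The symplectic form and the energy *)

Section Functionals.
Variables (R : realType) (p : R).
Hypothesis p1 : 1 < p.
Local Notation mu := (@lebesgue_measure R).
Local Notation L2 f := (f \in Lfun mu 2%:E).
Local Notation V := (H1 R).
Implicit Types (u v w : V) (f g h : nat -> R -> R) (z : nat -> R) (i : nat).

(** Truncation to [-B, B]. *)
Definition clip (B t : R) : R := Num.max (- B) (Num.min B t).

Lemma clip_bound (B t : R) : 0 <= B -> `|clip B t| <= B.
Proof.
move=> B0; rewrite ler_norml /clip le_max lexx/= ge_max ge_min lexx/= andbT.
lra.
Qed.

Lemma clip_id (B t : R) : `|t| <= B -> clip B t = t.
Proof.
rewrite ler_norml => /andP[a b]; rewrite /clip.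
by rewrite (min_idPr b) (max_idPr a).
Qed.

Lemma clip_le (B t : R) : 0 <= B -> `|clip B t| <= `|t|.
Proof.
move=> B0; have [tB|Bt] := lerP `|t| B; first by rewrite clip_id.
by apply: (le_trans (clip_bound t B0)); exact: ltW.
Qed.

Lemma measurable_clip (B : R) (f : R -> R) : measurable_fun setT f ->
  measurable_fun setT (fun x => clip B (f x)).
Proof.
by move=> mf; apply: measurable_maxr => //; apply: measurable_minr.
Qed.

Lemma represents_integrable u f : represents u f -> mu.-integrable setT
  (EFin \o (fun x => f 0 x ^+ 2 + f 1 x ^+ 2 + (f 2 x ^+ 2 + f 3 x ^+ 2))).
Proof.
by move=> [fL _]; repeat apply: integrableD_EFin => //; exact: Lfun2_integrable_sqr.
Qed.

Lemma represents_L2norm u f i : represents u f -> (i < 4)%N -> L2norm (f i) <= `|u|.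
Proof.
move=> uf i4; rewrite -[leRHS]ger0_norm// -sqrtr_sqr ler_wsqrtr// (represents_norm uf).
apply: le_Rintegral => //.
- by apply: Lfun2_integrable_sqr; case: uf.
- exact: represents_integrable uf.
- move=> x _; have s j := sqr_ge0 (f j x).
  have := (s 0%N, s 1%N, s 2%N, s 3%N) => -[[[s0 s1] s2] s3].
  by case: i i4 => [|[|[|[|//]]]] _; lra.
Qed.

(** By the Sobolev embedding, truncation at height [M * `|u|] changes the values of
    [u] on a negligible set only. *)
Lemma bounded_representative : exists2 M : R, 0 <= M & forall u, exists2 f,
  represents u f & forall x, `|f 0 x| <= M * `|u| /\ `|f 1 x| <= M * `|u|.
Proof.
have [M M0 HM] := sobolev_bound R.
exists (2 * M); first by rewrite mulr_ge0.
move=> u; set B := 2 * M * `|u|.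
have B0 : 0 <= B by rewrite !mulr_ge0.
exists (fun i => if (i < 2)%N then fun x => clip B (coord u i x) else coord u i); last first.
  by move=> x; rewrite !clip_bound.
split.
  move=> i; case: ifP => _; last exact: coord_L2.
  apply: (@Lfun2_le _ _ (coord u i)); last by move=> x; exact: clip_le.
    by apply: measurable_clip; apply: Lfun2_measurable; exact: coord_L2.
  exact: coord_L2.
have nb i := represents_L2norm (i := i) (coord_represents u).
have H i : (i < 2)%N -> {ae mu, forall x, `|coord u i x| <= B}.
  move=> i2; have := HM _ _ (coord_L2 u i) (coord_L2 u i.+2) (fun phi => coord_weak u i2).
  apply: (@filterS _ _ (ae_filter_ringOfSetsType mu)) => x h; apply: (le_trans h).
  have a1 : L2norm (coord u i) <= `|u| by apply: nb; rewrite (leq_trans i2).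
  have a2 : L2norm (coord u i.+2) <= `|u| by exact: nb.
  rewrite /B [2 * M]mulrC -mulrA ler_wpM2l//; lra.
move: (H 0%N isT) (H 1%N isT).
apply: (@filterS2 _ _ (ae_filter_ringOfSetsType mu)) => x h0 h1 i.
by case: i => [|[|i]] //=; rewrite clip_id.
Qed.

(** The densities of [omega], of [hamiltonian] and of the differential [grad] of the
    latter, in terms of coordinates. *)
Definition omega_d z z' : R := z 1 * z' 0 - z 0 * z' 1.

Definition ham_d z : R := 4^-1 * (z 2 ^+ 2 + z 3 ^+ 2) -
  (p + 1)^-1 * norm2 (z 0) (z 1) `^ (p + 1).

Definition grad_d z z' : R := 2^-1 * (z 2 * z' 2 + z 3 * z' 3) -
  norm2 (z 0) (z 1) `^ (p - 1) * (z 0 * z' 0 + z 1 * z' 1).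

Lemma omegaE u v f g : represents u f -> represents v g ->
  omega u v = \int[mu]_x omega_d (f^~ x) (g^~ x).
Proof.
move=> uf vg; rewrite -(represents_integral2 uf vg).
  rewrite /omega /cintegral /=; apply: eq_Rintegral => x _.
  rewrite /omega_d /coord.
  by case: (h1_fun u x) (h1_fun v x) => [a b] [c d] /=; ring.
move=> {uf vg} {}f {}g fL gL.
have mf i : measurable_fun setT (f i) by exact: Lfun2_measurable.
have mg i : measurable_fun setT (g i) by exact: Lfun2_measurable.
by apply: measurable_funB; apply: measurable_funM.
Qed.

Lemma omega_d_integrable u v f g : represents u f -> represents v g ->
  mu.-integrable setT (EFin \o (fun x => omega_d (f^~ x) (g^~ x))).
Proof.
by move=> [fL _] [gL _]; apply: integrableB_EFin => //; exact: Lfun2M_integrable.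
Qed.

Lemma omegaC u v : omega u v = - omega v u.
Proof.
have uf := coord_represents u; have vg := coord_represents v.
rewrite (omegaE uf vg) (omegaE vg uf) -mulN1r -RintegralZl//; last exact: (omega_d_integrable vg uf).
by apply: eq_Rintegral => x _; rewrite /omega_d; ring.
Qed.

Lemma omega_linl (a : R) u v w : omega (a *: u + v) w = a * omega u w + omega v w.
Proof.
have uf := coord_represents u; have vg := coord_represents v.
have wh := coord_represents w.
rewrite (omegaE (represents_lin a uf vg) wh) (omegaE uf wh) (omegaE vg wh).
have i1 := omega_d_integrable uf wh; have i2 := omega_d_integrable vg wh.
rewrite -RintegralZl// -RintegralD//; last exact: integrableZ_EFin.
by apply: eq_Rintegral => x _; rewrite /omega_d; ring.
Qed.

Lemma omega_bound u v : `|omega u v| <= 2 * `|u| * `|v|.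
Proof.
have uf := coord_represents u; have vg := coord_represents v.
have [fL _] := uf; have [gL _] := vg.
rewrite (omegaE uf vg) RintegralB//; [|exact: Lfun2M_integrable..].
have cs i j : (i < 4)%N -> (j < 4)%N ->
    `|\int[mu]_x (coord u i x * coord v j x)| <= `|u| * `|v|.
  move=> i4 j4; apply: le_trans (L2_cauchy_schwarz (fL i) (gL j)) _.
  by rewrite ler_pM ?L2norm_ge0//; [exact: represents_L2norm uf _|exact: represents_L2norm vg _].
apply: le_trans (ler_normB _ _) _.
have := cs 1%N 0%N isT isT; have := cs 0%N 1%N isT isT; lra.
Qed.

(** The differential of the energy at [u], in the direction [v]. *)
Definition grad u v : R := \int[mu]_x grad_d (coord u ^~ x) (coord v ^~ x).

Lemma measurable_norm2 (a b : R -> R) : measurable_fun setT a -> measurable_fun setT b ->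
  measurable_fun setT (fun x => norm2 (a x) (b x)).
Proof.
move=> ma mb; have ms : measurable_fun setT (@Num.sqrt R).
  by apply: continuous_measurable_fun; exact: sqrt_continuous.
apply: (measurableT_comp ms).
by apply: measurable_funD; apply: measurable_funX.
Qed.

Lemma measurable_norm2_powR (a b : R -> R) q : measurable_fun setT a -> measurable_fun setT b ->
  measurable_fun setT (fun x => norm2 (a x) (b x) `^ q).
Proof.
by move=> ma mb; apply: (measurableT_comp (measurable_powR _)); exact: measurable_norm2.
Qed.

Lemma hamiltonianE u f : represents u f ->
  hamiltonian p u = \int[mu]_x ham_d (f^~ x).
Proof.
move=> uf; rewrite -(represents_integral uf).
  apply: eq_Rintegral => x _; rewrite /ham_d /coord.
  case: (h1_fun u x) (h1_deriv u x) => [a b] [c d].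
  by rewrite -[X in _ = 4^-1 * X - _]norm2_sqr.
move=> {uf} {}f fL.
have mf i : measurable_fun setT (f i) by exact: Lfun2_measurable.
apply: measurable_funB; apply: measurable_funM => //.
  by apply: measurable_funD; apply: measurable_funX.
exact: measurable_norm2_powR.
Qed.

Lemma gradE u v f g : represents u f -> represents v g ->
  grad u v = \int[mu]_x grad_d (f^~ x) (g^~ x).
Proof.
move=> uf vg; rewrite -(represents_integral2 uf vg)//.
move=> {uf vg} {}f {}g fL gL.
have mf i : measurable_fun setT (f i) by exact: Lfun2_measurable.
have mg i : measurable_fun setT (g i) by exact: Lfun2_measurable.
apply: measurable_funB; apply: measurable_funM => //.
- by apply: measurable_funD; apply: measurable_funM.
- exact: measurable_norm2_powR.
- by apply: measurable_funD; apply: measurable_funM.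
Qed.

(** The modulus of the function represented by [f] is everywhere at most [B]. *)
Definition bounded_rep (B : R) f := forall x, norm2 (f 0 x) (f 1 x) <= B.

Lemma grad_d_integrable B u v f g : represents u f -> bounded_rep B f -> represents v g ->
  mu.-integrable setT (EFin \o (fun x => grad_d (f^~ x) (g^~ x))).
Proof.
move=> [fL _] fB [gL _].
have mf i : measurable_fun setT (f i) by exact: Lfun2_measurable.
have i1 j : mu.-integrable setT (EFin \o (fun x => norm2 (f 0 x) (f 1 x) `^ (p - 1) * f j x * g j x)).
  apply: Lfun2M_integrable => //; apply: (@Lfun2_bounded _ (B `^ (p - 1))) => //.
    exact: measurable_norm2_powR.
  move=> x; rewrite ger0_norm ?powR_ge0//; apply: ge0_ler_powR (fB x).
  - by rewrite subr_ge0 ltW.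
  - by rewrite nnegrE norm2_ge0.
  - by rewrite nnegrE (le_trans (norm2_ge0 _ _) (fB x)).
apply: integrableB_EFin => //.
  apply: integrableZ_EFin => //.
  by apply: integrableD_EFin => //; exact: Lfun2M_integrable.
have := integrableD_EFin measurableT (i1 0%N) (i1 1%N).
by apply: eq_integrable => // x _ /=; congr (_%:E); ring.
Qed.

Lemma ham_d_integrable B u f : represents u f -> bounded_rep B f ->
  mu.-integrable setT (EFin \o (fun x => ham_d (f^~ x))).
Proof.
move=> uf fB; have [fL _] := uf.
have i1 := Lfun2_integrable_sqr (fL 2); have i2 := Lfun2_integrable_sqr (fL 3).
have i3 := grad_d_integrable uf fB uf.
have i4 := integrableD_EFin measurableT i1 i2.
(* The power of the modulus occurs in [grad_d z z] with the same exponent, so [ham_d] is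
   a combination of the latter and of the squares of the derivatives. *)
have := integrableD_EFin measurableT (integrableZ_EFin (4^-1 - 2^-1 * (p + 1)^-1) measurableT i4)
  (integrableZ_EFin (p + 1)^-1 measurableT i3).
apply: eq_integrable => // x _ /=; congr (_%:E); rewrite /ham_d /grad_d.
have -> : f 0 x * f 0 x + f 1 x * f 1 x = norm2 (f 0 x) (f 1 x) ^+ 2 by rewrite norm2_sqr !expr2.
set n := norm2 _ _; have n0 : 0 <= n by exact: norm2_ge0.
have -> : n `^ (p + 1) = n ^+ 2 * n `^ (p - 1).
  have p0 : 0 < p by exact: lt_trans ltr01 p1.
  have p10 : 0 < p + 1 by rewrite addr_gt0.
  by rewrite -(mulr_powRB1 n0 p10) addrK -(mulr_powRB1 n0 p0) mulrA expr2.
ring.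
Qed.

End Functionals.

Section Energy.
Variables (R : realType) (p : R).
Hypothesis p1 : 1 < p.
Local Notation mu := (@lebesgue_measure R).
Local Notation L2 f := (f \in Lfun mu 2%:E).
Local Notation V := (H1 R).
Local Notation grad := (grad p).
Implicit Types (u v w : V) (f g h : nat -> R -> R) (z : nat -> R) (i : nat).

Lemma bounded_rep_exists : exists2 M : R, 0 <= M & forall u, exists2 f,
  represents u f & bounded_rep (M * `|u|) f.
Proof.
have [M M0 HM] := bounded_representative R.
exists (2 * M); first by rewrite mulr_ge0.
move=> u; have [f uf fB] := HM u; exists f => // x.
have [b0 b1] := fB x; apply: (@le_trans _ _ (`|f 0 x| + `|f 1 x|)); last lra.
rewrite -ler_sqr ?nnegrE ?norm2_ge0 ?addr_ge0// norm2_sqr sqrrD !real_normK ?num_real//.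
have : 0 <= `|f 0 x| * `|f 1 x| by rewrite mulr_ge0.
lra.
Qed.

Lemma grad_linr (a : R) u v w : grad u (a *: v + w) = a * grad u v + grad u w.
Proof.
have [M M0 HM] := bounded_rep_exists.
have [f uf fB] := HM u.
have vg := coord_represents v; have wh := coord_represents w.
rewrite (gradE _ uf (represents_lin a vg wh)) (gradE _ uf vg) (gradE _ uf wh).
have i1 := grad_d_integrable p1 uf fB vg; have i2 := grad_d_integrable p1 uf fB wh.
rewrite -RintegralZl// -RintegralD//; last exact: integrableZ_EFin.
by apply: eq_Rintegral => x _; rewrite /grad_d; ring.
Qed.

Lemma represents_diff u v f g : represents u f -> represents v g ->
  represents (v - u) (fun i x => g i x - f i x).
Proof.
move=> uf vg; have := represents_lin (-1) uf vg.
rewrite scaleN1r addrC (_ : (fun i x => _) = (fun i x => g i x - f i x))//.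
by apply/funext => i; apply/funext => x; rewrite mulN1r addrC.
Qed.

Lemma norm2_L2 u f : represents u f ->
  L2 (fun x => norm2 (f 0 x) (f 1 x)) /\ L2norm (fun x => norm2 (f 0 x) (f 1 x)) <= `|u|.
Proof.
move=> uf; have [fL _] := uf.
have mf i : measurable_fun setT (f i) by exact: Lfun2_measurable.
have i0 := Lfun2_integrable_sqr (fL 0); have i1 := Lfun2_integrable_sqr (fL 1).
have nL : L2 (fun x => norm2 (f 0 x) (f 1 x)).
  apply/Lfun2P; split; first exact: measurable_norm2.
  have := integrableD_EFin measurableT i0 i1.
  by apply: eq_integrable => // x _ /=; rewrite norm2_sqr.
split=> //; rewrite -[leRHS]ger0_norm// -sqrtr_sqr ler_wsqrtr// (represents_norm uf).
apply: le_Rintegral => //.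
- exact: Lfun2_integrable_sqr.
- exact: represents_integrable uf.
- by move=> x _; rewrite norm2_sqr lerDl addr_ge0 ?sqr_ge0.
Qed.

(** The differential of the energy is Lipschitz on bounded sets. *)
Lemma grad_lip : exists C : R -> R, (forall K, 0 <= C K) /\ forall K u v w,
  `|u| <= K -> `|v| <= K -> `|grad v w - grad u w| <= C K * `|v - u| * `|w|.
Proof.
have [M M0 HM] := bounded_rep_exists.
pose k (K : R) : R := (2 + (p - 1)) * (M * `|K|) `^ (p - 1).
have p10 : 0 < p - 1 by rewrite subr_gt0.
have k0 K : 0 <= k K by rewrite mulr_ge0 ?powR_ge0// addr_ge0// ltW.
exists (fun K => 1 + 2 * k K); split; first by move=> K; apply: addr_ge0 => //; apply: mulr_ge0.
move=> K u v w uK vK.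
have K0 : 0 <= K by exact: le_trans uK.
have kE : k K = (2 + (p - 1)) * (M * K) `^ (p - 1) by rewrite /k ger0_norm.
have [f uf fB] := HM u; have [g vg gB] := HM v.
have wh := coord_represents w; set h := coord w in wh.
have dr := represents_diff uf vg; set d := (fun i x => _) in dr.
have [dL _] := dr; have [hL _] := wh.
have [nL nB] := norm2_L2 dr; set n := (fun x => _) in nL nB.
rewrite (gradE _ uf wh) (gradE _ vg wh) -RintegralB//; last 2 first.
- exact: (grad_d_integrable p1 vg gB wh).
- exact: (grad_d_integrable p1 uf fB wh).
have cs (a b : R -> R) : L2 a -> L2 b -> mu.-integrable setT (EFin \o (fun x => `|a x| * `|b x|)).
  move=> aL bL; have := integrable_norm (Lfun2M_integrable aL bL).
  by apply: eq_integrable => // x _ /=; rewrite normrM.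
have cb i : (i < 4)%N -> \int[mu]_x (`|d i x| * `|h i x|) <= `|v - u| * `|w|.
  move=> i4; apply: le_trans (L2_cauchy_schwarz_abs (dL i) (hL i)) _.
  by rewrite ler_pM ?L2norm_ge0//; [exact: represents_L2norm dr _|exact: represents_L2norm wh _].
have cn i : (i < 4)%N -> \int[mu]_x (`|n x| * `|h i x|) <= `|v - u| * `|w|.
  move=> i4; apply: le_trans (L2_cauchy_schwarz_abs nL (hL i)) _.
  by rewrite ler_pM ?L2norm_ge0//; exact: represents_L2norm wh _.
have ib i := cs _ _ (dL i) (hL i).
have inn i := cs _ _ nL (hL i).
have I1 := integrableZ_EFin 2^-1 measurableT (integrableD_EFin measurableT (ib 2%N) (ib 3%N)).
have I2 := integrableZ_EFin (k K) measurableT (integrableD_EFin measurableT (inn 0%N) (inn 1%N)).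
have I3 := integrableB_EFin measurableT (grad_d_integrable p1 vg gB wh) (grad_d_integrable p1 uf fB wh).
apply: le_trans (le_normr_Rintegral measurableT I3) _.
apply: (@le_trans _ _ (\int[mu]_x (2^-1 * (`|d 2 x| * `|h 2 x| + `|d 3 x| * `|h 3 x|) +
   k K * (`|n x| * `|h 0 x| + `|n x| * `|h 1 x|)))).
  apply: le_Rintegral => //.
  - exact: integrable_norm I3.
  - exact: integrableD_EFin.
  - move=> x _; rewrite /grad_d.
    have fK : norm2 (f 0 x) (f 1 x) <= M * K by apply: le_trans (fB x) _; rewrite ler_wpM2l.
    have gK : norm2 (g 0 x) (g 1 x) <= M * K by apply: le_trans (gB x) _; rewrite ler_wpM2l.
    have l1 := powR_field_lip p10 fK gK.
    have l2 : `|norm2 (g 0 x) (g 1 x) `^ (p - 1) * g 1 x - norm2 (f 0 x) (f 1 x) `^ (p - 1) * f 1 x| <=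
        (2 + (p - 1)) * (M * K) `^ (p - 1) * norm2 (g 0 x - f 0 x) (g 1 x - f 1 x).
      by apply: powR_field_lip_r.
    rewrite -kE -[norm2 (g 0 x - f 0 x) _]/(n x) in l1 l2.
    have n0 : 0 <= n x by exact: norm2_ge0.
    rewrite (ger0_norm n0).
    set X := _ - _ in l1; set Y := _ - _ in l2.
    rewrite (_ : _ - _ = 2^-1 * (d 2 x * h 2 x + d 3 x * h 3 x) - (X * h 0 x + Y * h 1 x)); last first.
      by rewrite /X /Y /d; ring.
    apply: le_trans (ler_normB _ _) _; apply: lerD.
      rewrite normrM ger0_norm// ler_wpM2l//.
      by apply: le_trans (ler_normD _ _) _; rewrite !normrM.
    apply: le_trans (ler_normD _ _) _; rewrite mulrDr !normrM !mulrA.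
    by apply: lerD; rewrite ler_wpM2r.
have J1 := integrableD_EFin measurableT (ib 2%N) (ib 3%N).
have J2 := integrableD_EFin measurableT (inn 0%N) (inn 1%N).
rewrite RintegralD// RintegralZl// RintegralZl// !RintegralD//.
have := cb 2%N isT; have := cb 3%N isT.
have := ler_wpM2l (k0 K) (cn 0%N isT); have := ler_wpM2l (k0 K) (cn 1%N isT).
lra.
Qed.

(** The energy is differentiable with differential [grad], and the remainder is
    quadratic, uniformly on bounded sets. *)
Lemma ham_taylor : exists C : R -> R, (forall K, 0 <= C K) /\ forall K u v,
  `|u| <= K -> `|v| <= K ->
  `|hamiltonian p v - hamiltonian p u - grad u (v - u)| <= C K * `|v - u| ^+ 2.
Proof.
have [M M0 HM] := bounded_rep_exists.
pose k (K : R) : R := 2 * ((2 + (p - 1)) * (M * `|K|) `^ (p - 1)).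
have p10 : 0 < p - 1 by rewrite subr_gt0.
have k0 K : 0 <= k K by rewrite !mulr_ge0 ?powR_ge0// addr_ge0// ltW.
exists (fun K => 1 + k K); split; first by move=> K; apply: addr_ge0.
move=> K u v uK vK.
have K0 : 0 <= K by exact: le_trans uK.
have [f uf fB] := HM u; have [g vg gB] := HM v.
have dr := represents_diff uf vg; set d := (fun i x => _) in dr.
have J1 := ham_d_integrable p1 vg gB; have J2 := ham_d_integrable p1 uf fB.
have J3 := grad_d_integrable p1 uf fB dr.
have J4 := integrableB_EFin measurableT J1 J2.
rewrite (hamiltonianE _ uf) (hamiltonianE _ vg) (gradE _ uf dr) -!RintegralB//.
have J5 := integrableB_EFin measurableT J4 J3.
have J6 := represents_integrable dr.
apply: le_trans (le_normr_Rintegral measurableT J5) _.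
rewrite (represents_norm dr) -RintegralZl//.
apply: le_Rintegral => //.
- exact: integrable_norm J5.
- exact: integrableZ_EFin.
move=> x _; rewrite /ham_d /grad_d.
have fK : norm2 (f 0 x) (f 1 x) <= M * K by apply: le_trans (fB x) _; rewrite ler_wpM2l.
have gK : norm2 (g 0 x) (g 1 x) <= M * K by apply: le_trans (gB x) _; rewrite ler_wpM2l.
have := powR_taylor p10 fK gK; rewrite norm2_sqr.
rewrite (_ : p - 1 + 2 = p + 1); last by ring.
set T := (X in `|X| <= _) => hT.
have pp : 0 < p + 1 by rewrite addr_gt0// (lt_trans ltr01 p1).
have {}hT : `|(p + 1)^-1 * T| <= k K * (d 0 x ^+ 2 + d 1 x ^+ 2).
  rewrite normrM gtr0_norm ?invr_gt0// mulrC ler_pdivrMr//; apply: (le_trans hT).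
  by rewrite /k ger0_norm// le_eqVlt; apply/orP; left; apply/eqP; rewrite /d; ring.
rewrite (_ : _ - _ = 4^-1 * (d 2 x ^+ 2 + d 3 x ^+ 2) - (p + 1)^-1 * T); last first.
  by rewrite /T /d; field; rewrite gt_eqF.
apply: le_trans (ler_normB _ _) _.
have s i : 0 <= d i x ^+ 2 by exact: sqr_ge0.
rewrite ger0_norm ?mulr_ge0 ?addr_ge0//.
have := (s 0%N, s 1%N, s 2%N, s 3%N) => -[[[s0 s1] s2] s3].
have := mulr_ge0 (k0 K) s2; have := mulr_ge0 (k0 K) s3.
lra.
Qed.

End Energy.

(** * Differential calculus within a set *)

(** The increments along which slopes within [J] are taken. *)
Local Notation incr J x := (within (fun h => J (x + h)) 0^').

Section Slopes.
Variable R : realType.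
Implicit Types (E : normedModType R) (J : set R).

Lemma near_incr J (x : R) : \forall h \near incr J x, J (x + h).
Proof. exact: withinT. Qed.

Lemma near_incr_neq0 J (x : R) : \forall h \near incr J x, h != 0.
Proof. by have := nbhs_dnbhs_neq (0 : R); apply: cvg_within. Qed.

Lemma slope_within_ext E J (f g : R -> E) (x : R) (l : E) : J x -> (forall y, J y -> f y = g y) ->
  slope_within J f x --> l -> slope_within J g x --> l.
Proof.
move=> Jx fg; apply: cvg_trans; apply: near_eq_cvg.
by have := near_incr J x; apply: filterS => h Jh; rewrite !fg.
Qed.

Lemma incr_cvg0 J (x : R) : h @[h --> incr J x] --> (0 : R).
Proof. by apply: cvg_within_filter; apply: cvg_within_filter; exact: cvg_id. Qed.

Lemma slope_within_cvg E J (f : R -> E) (x : R) (l : E) : slope_within J f x --> l ->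
  f (x + h) @[h --> incr J x] --> f x.
Proof.
move=> fl.
have : h *: (h^-1 *: (f (x + h) - f x)) + f x @[h --> incr J x] --> 0 *: l + f x.
  apply: cvgD; last exact: cvg_cst.
  by apply: (@cvgZ _ _ _ _ _ id); [exact: incr_cvg0|exact: fl].
rewrite scale0r add0r; apply: cvg_trans; apply: near_eq_cvg.
have := near_incr_neq0 J x; apply: filterS => h h0.
by rewrite scalerA divff// scale1r subrK.
Qed.

Lemma slope_within_sub E J J' (f : R -> E) (x : R) (l : E) : J' `<=` J ->
  slope_within J f x --> l -> slope_within J' f x --> l.
Proof.
move=> J'J; apply: cvg_trans => A H.
have {}H : \forall h \near (0 : R)^', J (x + h) -> A (h^-1 *: (f (x + h) - f x)) by exact: H.
have : \forall h \near (0 : R)^', J' (x + h) -> A (h^-1 *: (f (x + h) - f x)).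
  by apply: filterS H => h Hh /J'J; exact: Hh.
exact.
Qed.

Lemma cvg_dist_bound (T : Type) (F : set_system T) (FF : Filter F) (f e : T -> R) (l : R) :
  e @ F --> (0 : R) -> (\forall t \near F, `|f t - l| <= e t) -> f @ F --> l.
Proof.
move=> e0 fe; apply/cvgrPdist_le => eps eps0.
have H := cvgr_le _ e0 _ eps0.
near=> t; rewrite distrC; apply: (@le_trans _ _ (e t)); near: t; [exact: fe|exact: H].
Unshelve. all: by end_near.
Qed.

Lemma cvg_dist0 E (T : Type) (F : set_system T) (FF : Filter F) (f : T -> E) (a : E) :
  f @ F --> a -> `|f t - a| @[t --> F] --> (0 : R).
Proof.
move=> fa; rewrite -(@normr0 _ E) -(subrr a).
by apply: cvg_norm; apply: cvgB => //; exact: cvg_cst.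
Qed.

(** On an open set, slopes within the set give the usual derivative. *)
Lemma slope_within_open J (f : R -> R) (x l : R) : open J -> J x ->
  slope_within J f x --> l -> is_derive x 1 f l.
Proof.
move=> oJ Jx fl.
have h : h^-1 *: (f (h + x) - f x) @[h --> 0^'] --> l.
  move: fl; apply: cvg_trans => A; rewrite /slope_within => H.
  have {}H : \forall h \near (0 : R)^', J (x + h) -> A (h^-1 *: (f (x + h) - f x)) by exact: H.
  have Jn : \forall h \near (0 : R)^', J (x + h).
    apply: nbhs_dnbhs.
    have : (fun h : R => x + h) @ (0 : R) --> x.
      by rewrite -[X in _ --> X]addr0; apply: cvgD; [exact: cvg_cst|exact: cvg_id].
    by apply; move: oJ; rewrite openE => /(_ _ Jx).
  by apply: filterS2 H Jn => h H Jh; rewrite /= (addrC h); exact: H.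
apply: DeriveDef.
  by apply/cvg_ex; exists l; under eq_fun do rewrite scaler1.
by apply/cvg_lim => //; under eq_fun do rewrite scaler1.
Qed.

End Slopes.

Section ActionForm.
Variables (R : realType) (p : R).
Hypothesis p1 : 1 < p.
Local Notation V := (H1 R).
Local Notation W := (V * R)%type.
Local Notation grad := (grad p).
Local Notation ham := (hamiltonian p).
Implicit Types (u v w : V) (J : set R).

Lemma omega_linr (a : R) u v w : omega w (a *: u + v) = a * omega w u + omega w v.
Proof. by rewrite omegaC omega_linl (omegaC w u) (omegaC w v); ring. Qed.

Lemma omegaBl u v w : omega (u - v) w = omega u w - omega v w.
Proof. by rewrite addrC -scaleN1r omega_linl; ring. Qed.

Lemma omegaBr u v w : omega w (u - v) = omega w u - omega w v.
Proof. by rewrite addrC -scaleN1r omega_linr; ring. Qed.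

Lemma omegaZl a u v : omega (a *: u) v = a * omega u v.
Proof.
have Z : omega (0 : V) v = 0 by rewrite -(subrr u) omegaBl subrr.
by rewrite -[a *: u]addr0 omega_linl Z addr0.
Qed.

Lemma omegaZr a u v : omega u (a *: v) = a * omega u v.
Proof. by rewrite omegaC omegaZl (omegaC u); ring. Qed.

Lemma gradBr u v w : grad u (v - w) = grad u v - grad u w.
Proof. by rewrite addrC -scaleN1r grad_linr//; ring. Qed.

Lemma gradZr a u v : grad u (a *: v) = a * grad u v.
Proof.
have Z : grad u 0 = 0 by rewrite -(subrr v) gradBr subrr.
by rewrite -[a *: v]addr0 grad_linr// Z addr0.
Qed.

Lemma grad0l w : grad 0 w = 0.
Proof.
have uf := coord_represents (0 : V); have wh := coord_represents w.
have := represents_lin (-1) uf uf; rewrite scaleN1r addNr => r0.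
rewrite (gradE _ r0 wh) [X in Rintegral _ _ X](_ : _ = cst 0).
  by rewrite /Rintegral integral0.
apply/funext => x; rewrite /grad_d.
have z (t : R) : -1 * t + t = 0 by ring.
rewrite !z !mul0r !addr0 !mulr0 subrr. done.
Qed.

Lemma grad_bound : exists C : R -> R, (forall K, 0 <= C K) /\ forall K u w,
  `|u| <= K -> `|grad u w| <= C K * `|u| * `|w|.
Proof.
have [C [C0 HC]] := grad_lip p1; exists C; split=> // K u w uK.
have K0 : `|0 : V| <= K by rewrite normr0 (le_trans _ uK).
by have := HC K _ _ w K0 uK; rewrite grad0l !subr0.
Qed.

Section Limits.
Context {T : Type} {F : set_system T} {FF : Filter F}.

Lemma omega_cvg (f g : T -> V) (a b : V) : f @ F --> a -> g @ F --> b ->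
  omega (f t) (g t) @[t --> F] --> omega a b.
Proof.
move=> fa gb.
apply: (@cvg_dist_bound _ _ _ _ _
  (fun t => 2 * `|f t - a| * `|g t| + 2 * `|a| * `|g t - b|)).
  rewrite (_ : 0 = 2 * 0 * `|b| + 2 * `|a| * 0); last by ring.
  apply: cvgD; apply: cvgM; [|exact: cvg_norm|exact: cvg_cst|exact: cvg_dist0].
  by apply: cvgM; [exact: cvg_cst|exact: cvg_dist0].
apply: nearW => t.
rewrite (_ : _ - _ = omega (f t - a) (g t) + omega a (g t - b)).
  by rewrite (le_trans (ler_normD _ _))// lerD// omega_bound.
by rewrite omegaBl omegaBr; ring.
Qed.

Lemma near_norm_le (f : T -> V) (a : V) : f @ F --> a ->
  \forall t \near F, `|f t| <= `|a| + 1.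
Proof. by move=> fa; apply: (cvgr_norm_le _ fa); rewrite ltrDl. Qed.

Lemma grad_cvg (f g : T -> V) (a b : V) : f @ F --> a -> g @ F --> b ->
  grad (f t) (g t) @[t --> F] --> grad a b.
Proof.
move=> fa gb; have [C [C0 HC]] := grad_lip p1; have [C' [C'0 HC']] := grad_bound.
set K := `|a| + 1.
apply: (@cvg_dist_bound _ _ _ _ _
  (fun t => C' K * `|f t| * `|g t - b| + C K * `|f t - a| * `|b|)).
  rewrite (_ : 0 = C' K * `|a| * 0 + C K * 0 * `|b|); last by ring.
  apply: cvgD; apply: cvgM; [|exact: cvg_dist0| |exact: cvg_cst].
    by apply: cvgM; [exact: cvg_cst|exact: cvg_norm].
  by apply: cvgM; [exact: cvg_cst|exact: cvg_dist0].
have := near_norm_le fa; apply: filterS => t ft.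
rewrite (_ : _ - _ = grad (f t) (g t - b) + (grad (f t) b - grad a b)).
  rewrite (le_trans (ler_normD _ _))// lerD//; first exact: HC'.
  by apply: HC => //; rewrite lerDl.
by rewrite gradBr; ring.
Qed.

Lemma ham_cvg (f : T -> V) (a : V) : f @ F --> a -> ham (f t) @[t --> F] --> ham a.
Proof.
move=> fa; have [C [C0 HC]] := ham_taylor p1.
set K := `|a| + 1.
have fa0 : f t - a @[t --> F] --> (0 : V).
  by rewrite -(subrr a); apply: cvgB => //; exact: cvg_cst.
apply: (@cvg_dist_bound _ _ _ _ _
  (fun t => `|grad a (f t - a)| + C K * `|f t - a| ^+ 2)).
  rewrite (_ : 0 = `|grad a 0| + C K * (0 * 0)); last first.
    by rewrite -(subrr a) gradBr subrr normr0; ring.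
  apply: cvgD; first by apply: cvg_norm; apply: grad_cvg => //; exact: cvg_cst.
  by apply: cvgM; [exact: cvg_cst|apply: cvgM; exact: cvg_dist0].
have := near_norm_le fa; apply: filterS => t ft.
have aK : `|a| <= K by rewrite lerDl.
have := HC K a (f t) aK ft.
set X := ham (f t) - ham a; set Y := grad a _ => h.
have -> : X = Y + (X - Y) by ring.
by rewrite (le_trans (ler_normD _ _))// lerD.
Qed.

End Limits.

Lemma omega_slope J (f g : R -> V) (x : R) (f' g' : V) :
  slope_within J f x --> f' -> slope_within J g x --> g' ->
  slope_within J (fun t => omega (f t) (g t) : R) x --> omega f' (g x) + omega (f x) g'.
Proof.
move=> ff gg.
have : omega (h^-1 *: (f (x + h) - f x)) (g (x + h)) +
    omega (f x) (h^-1 *: (g (x + h) - g x)) @[h --> incr J x] -->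
    omega f' (g x) + omega (f x) g'.
  apply: cvgD; apply: omega_cvg => //; first exact: slope_within_cvg gg.
  exact: cvg_cst.
apply: cvg_trans; apply: near_eq_cvg; apply: nearW => h.
by rewrite omegaZl omegaZr omegaBl omegaBr /GRing.scale/=; ring.
Qed.

Lemma mul_slope J (f g : R -> R) (x : R) (f' g' : R) :
  slope_within J f x --> f' -> slope_within J g x --> g' ->
  slope_within J (fun t => f t * g t : R) x --> f' * g x + f x * g'.
Proof.
move=> ff gg.
have : (h^-1 *: (f (x + h) - f x)) * (g (x + h)) +
    (f x) * (h^-1 *: (g (x + h) - g x)) @[h --> incr J x] -->
    f' * (g x) + (f x) * g'.
  apply: cvgD; apply: cvgM => //; first exact: slope_within_cvg gg.
  exact: cvg_cst.
apply: cvg_trans; apply: near_eq_cvg; apply: nearW => h.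
by rewrite /GRing.scale/=; ring.
Qed.

Lemma ham_slope J (f : R -> V) (x : R) (f' : V) : slope_within J f x --> f' ->
  slope_within J (fun t => ham (f t) : R) x --> grad (f x) f'.
Proof.
move=> ff; have fc := slope_within_cvg ff.
have [C [C0 HC]] := ham_taylor p1.
set K := `|f x| + 1.
pose s h := h^-1 *: (f (x + h) - f x).
apply: (@cvg_dist_bound _ _ _ _ _
  (fun h => C K * (`|h| * (`|s h| * `|s h|)) + `|grad (f x) (s h) - grad (f x) f'|)).
  rewrite [X in _ --> X](_ : _ = C K * (`|0 : R| * (`|f'| * `|f'|)) + 0 :> R); last first.
    by rewrite normr0; ring.
  apply: cvgD; last by apply: cvg_dist0; apply: grad_cvg; [exact: cvg_cst|exact: ff].
  apply: cvgM; first exact: cvg_cst.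
  by apply: cvgM; [apply: cvg_norm; exact: incr_cvg0|apply: cvgM; apply: cvg_norm; exact: ff].
have h0n := near_incr_neq0 J x.
have fcn := near_norm_le fc.
near=> h.
have h0 : h != 0 by near: h; exact: h0n.
have fxh : `|f (x + h)| <= K by near: h; exact: fcn.
have fK : `|f x| <= K by rewrite lerDl.
have := HC K (f x) (f (x + h)) fK fxh.
have E : f (x + h) - f x = h *: s h by rewrite scalerA divff// scale1r.
rewrite E gradZr => B.
rewrite -[_ *: _]/(h^-1 * (ham (f (x + h)) - ham (f x))).
move: B (grad (f x) f'); set G := grad (f x) (s h).
move: (ham (f (x + h)) - ham (f x)) => D B Y.
have -> : h^-1 * D - Y = h^-1 * (D - h * G) + (G - Y) by field.
rewrite (le_trans (ler_normD _ _))// lerD//.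
rewrite normrM normfV mulrC ler_pdivrMr ?normr_gt0//; apply: (le_trans B).
rewrite normrZ le_eqVlt; apply/orP; left; apply/eqP; ring.
Unshelve. all: by end_near.
Qed.

Lemma d_hamiltonianE u v : d_hamiltonian p u v = grad u v.
Proof.
have c : slope_within setT (fun s : R => u + s *: v) 0 --> v.
  have : (fun=> v) @ incr (setT : set R) (0 : R) --> v by exact: cvg_cst.
  apply: cvg_trans; apply: near_eq_cvg.
  have := near_incr_neq0 (setT : set R) (0 : R); apply: filterS => h h0.
  by rewrite add0r scale0r addr0 addrAC subrr add0r scalerA mulVf// scale1r.
have [_ e] := slope_within_open openT I (ham_slope c).
by rewrite /d_hamiltonian derive1E e scale0r addr0.
Qed.

(** The derivative of [alpha] at [(z, w)] in the direction [(z', w')], where [w] is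
    a tangent vector at [z]. *)
Definition d_alpha (z w z' w' : W) : R :=
  2^-1 * (omega z'.1 w.1 + omega z.1 w'.1) - (grad z.1 z'.1 * w.2 + ham z.1 * w'.2).

Lemma cvg_pair1 (T : Type) (F : set_system T) (q : T -> W) (l : W) :
  q @ F --> l -> (q t).1 @[t --> F] --> l.1.
Proof.
by move=> ql; apply: (@cvg_comp _ _ _ q fst F (nbhs l) (nbhs l.1) ql); exact: cvg_fst.
Qed.

Lemma cvg_pair2 (T : Type) (F : set_system T) (q : T -> W) (l : W) :
  q @ F --> l -> (q t).2 @[t --> F] --> l.2.
Proof.
by move=> ql; apply: (@cvg_comp _ _ _ q snd F (nbhs l) (nbhs l.2) ql); exact: cvg_snd.
Qed.

Lemma slope_fst J (f : R -> W) (x : R) (l : W) : slope_within J f x --> l ->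
  slope_within J (fun t => (f t).1) x --> l.1.
Proof. exact: (@cvg_pair1 _ _ (fun h => h^-1 *: (f (x + h) - f x))). Qed.

Lemma slope_snd J (f : R -> W) (x : R) (l : W) : slope_within J f x --> l ->
  slope_within J (fun t => (f t).2 : R) x --> l.2.
Proof. exact: (@cvg_pair2 _ _ (fun h => h^-1 *: (f (x + h) - f x))). Qed.

Lemma alpha_slope J (f g : R -> W) (x : R) (f' g' : W) :
  slope_within J f x --> f' -> slope_within J g x --> g' ->
  slope_within J (fun t => alpha p (f t) (g t) : R) x --> d_alpha (f x) (g x) f' g'.
Proof.
move=> ff gg.
have a1 := omega_slope (slope_fst ff) (slope_fst gg).
have a2 := mul_slope (ham_slope (slope_fst ff)) (slope_snd gg).
have : 2^-1 * (h^-1 *: (omega (f (x + h)).1 (g (x + h)).1 - omega (f x).1 (g x).1)) -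
   h^-1 *: (ham (f (x + h)).1 * (g (x + h)).2 - ham (f x).1 * (g x).2)
    @[h --> incr J x] --> d_alpha (f x) (g x) f' g'.
  by apply: cvgB; [apply: cvgM; [exact: cvg_cst|exact: a1]|exact: a2].
apply: cvg_trans; apply: near_eq_cvg; apply: nearW => h.
rewrite /alpha /GRing.scale/=.
move: (omega (f (x + h)).1 (g (x + h)).1) (omega (f x).1 (g x).1) => o1 o2.
move: (ham (f (x + h)).1) (ham (f x).1) (g (x + h)).2 (g x).2 => h1 h2 t1 t2.
by ring.
Qed.

(** For a family with derivatives [w] and [w'] and mixed second derivative [m], the
    variation of [alpha] differs from a total derivative by [omega_tilde]. This is
    the formula for the exterior derivative of [alpha]. *)
Lemma d_alpha_omega_tilde (z w w' m : W) :
  d_alpha z w' w m = d_alpha z w w' m + omega_tilde p z w w'.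
Proof.
rewrite /d_alpha /omega_tilde !d_hamiltonianE (omegaC w'.1 w.1).
by field.
Qed.

Section LimitsW.
Context {T : Type} {F : set_system T} {FF : Filter F}.

Lemma d_alpha_cvg (f g h k : T -> W) (a b c d : W) : f @ F --> a -> g @ F --> b ->
  h @ F --> c -> k @ F --> d ->
  d_alpha (f t) (g t) (h t) (k t) @[t --> F] --> d_alpha a b c d.
Proof.
move=> fa gb hc kd.
have [a1 b1] := (cvg_pair1 fa, cvg_pair1 gb); have [c1 d1] := (cvg_pair1 hc, cvg_pair1 kd).
have [b2 d2] := (cvg_pair2 gb, cvg_pair2 kd).
apply: cvgB.
  by apply: cvgM; [exact: cvg_cst|apply: cvgD; exact: omega_cvg].
by apply: cvgD; apply: cvgM; [exact: grad_cvg|exact: b2|exact: ham_cvg|exact: d2].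
Qed.

End LimitsW.

End ActionForm.

Section SlopesOnIntervals.
Variable R : realType.
Implicit Types (E : normedModType R) (J : set R).

(** Limits of slopes within an interval are unique, also at its endpoints. *)
Lemma incr_proper (a b s : R) : a < b -> `[a, b]%classic s -> ProperFilter (incr `[a, b]%classic s).
Proof.
move=> ab; rewrite /= in_itv/= => /andP[as_ sb].
apply: Build_ProperFilter_ex => A [e /= e0 eA].
have {}e0 : 0 < e :> R by exact: e0.
pose d : R := if s < b then Num.min (e / 2) (b - s) else - Num.min (e / 2) (b - a).
have dE : [/\ `|d| < e, d != 0 & a <= s + d <= b].
  rewrite /d; case: (ltP s b) => h.
    set m := Num.min _ _; have m0 : 0 < m by rewrite lt_min; apply/andP; split; lra.
    have m1 : m <= e / 2 by rewrite ge_min lexx.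
    have m2 : m <= b - s by rewrite ge_min lexx orbT.
    split; [|by rewrite gt_eqF|by apply/andP; split; lra].
    by rewrite gtr0_norm//; lra.
  set m := Num.min _ _; have m0 : 0 < m by rewrite lt_min; apply/andP; split; lra.
  have m1 : m <= e / 2 by rewrite ge_min lexx.
  have m2 : m <= b - a by rewrite ge_min lexx orbT.
  split; [|by rewrite oppr_eq0 gt_eqF|by apply/andP; split; lra].
  by rewrite normrN gtr0_norm//; lra.
have [d1 d2 d3] := dE.
exists d; apply: (eA d) => //=; first by rewrite sub0r normrN.
Qed.

Lemma open_itvoo (c d : R) : open (`]c, d[%classic : set R).
Proof. by rewrite openE => y; exact: near_in_itvoo. Qed.

Lemma derivative_withinE E (a b s : R) (f : R -> E) (l : E) : a < b -> `[a, b]%classic s ->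
  slope_within `[a, b]%classic f s --> l -> derivative_within `[a, b]%classic f s = l.
Proof.
move=> ab abs fl; have pf := incr_proper ab abs.
by apply: cvg_lim => //; exact: norm_hausdorff.
Qed.

Lemma slope_within_continuous E J (f f' : R -> E) :
  (forall x, J x -> slope_within J f x --> f' x) -> {within J, continuous f}.
Proof.
move=> H; apply/subspace_continuousP => x Jx.
have /= c := slope_within_cvg (H x Jx).
move=> A nA; have := c A nA; rewrite /within/= => -[e /= e0 eA].
exists e => //= y xy Jy; have [->|yx] := eqVneq y x; first exact: nbhs_singleton.
have := eA (y - x); rewrite (addrC x) subrK; apply => //.
  by rewrite /ball_/= sub0r normrN distrC.
by rewrite subr_eq0.
Qed.

End SlopesOnIntervals.

(** * The first variation of the action *)

Section Variation.
Variables (R : realType) (p : R).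
Hypothesis p1 : 1 < p.
Local Notation mu := (@lebesgue_measure R).
Local Notation V := (H1 R).
Local Notation W := (V * R)%type.
Variables (a b eps : R).
Hypotheses (ab : a < b) (eps0 : 0 < eps).
Local Notation I := (`]- eps, eps[%classic : set R).
Local Notation J := (`[a, b]%classic : set R).
(* [G m n] is the partial derivative of order [m] in the parameter and [n] along the
   curve of a family of curves. *)
Variable G : nat -> nat -> R -> R -> W.
Hypothesis Gc : forall m n, {within I `*` J, continuous (fun z : R * R => G m n z.1 z.2)}.
Hypothesis Gr : forall m n r s, I r -> J s ->
  slope_within I (fun r' => G m n r' s) r --> G m.+1 n r s.
Hypothesis Gs : forall m n r s, I r -> J s ->
  slope_within J (G m n r) s --> G m n.+1 r s.

(* The integrand of the action along the family, its derivative in the parameter, the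
   boundary term of the integration by parts, and the derivative of the latter. *)
Let phi r s := alpha p (G 0 0 r s) (G 0 1 r s).
Let psi r s := d_alpha p (G 0 0 r s) (G 0 1 r s) (G 1 0 r s) (G 1 1 r s).
Let bd s := alpha p (G 0 0 0 s) (G 1 0 0 s).
Let bd' s := d_alpha p (G 0 0 0 s) (G 1 0 0 s) (G 0 1 0 s) (G 1 1 0 s).

Let I0 : I 0. Proof. by rewrite /= in_itv/= oppr_lt0 eps0. Qed.

Let phi_r r s : I r -> J s -> is_derive r 1 (phi^~ s) (psi r s).
Proof.
move=> Ir Js; apply: (@slope_within_open _ I) => //.
exact (alpha_slope p1 (Gr (m := 0) (n := 0) Ir Js) (Gr (m := 0) (n := 1) Ir Js)).
Qed.

Let phi_s r : I r -> {within J, continuous (phi r)}.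
Proof.
move=> Ir; apply: (@slope_within_continuous _ _ _ _
  (fun s => d_alpha p (G 0 0 r s) (G 0 1 r s) (G 0 1 r s) (G 0 2 r s))) => s Js.
exact (alpha_slope p1 (Gs (m := 0) (n := 0) Ir Js) (Gs (m := 0) (n := 1) Ir Js)).
Qed.

Let bd_s s : J s -> slope_within J (bd : R -> R) s --> bd' s.
Proof.
by move=> Js; exact (alpha_slope p1 (Gs (m := 0) (n := 0) I0 Js) (Gs (m := 1) (n := 0) I0 Js)).
Qed.

Let Gcs m n r : I r -> {within J, continuous (G m n r)}.
Proof. by move=> Ir; apply: slope_within_continuous => s Js; exact: (Gs Ir Js). Qed.

Let bd'_s : {within J, continuous bd'}.
Proof.
apply/subspace_continuousP => s Js.
have c m n := (subspace_continuousP _ _).1 (@Gcs m n 0 I0) s Js.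
exact: (d_alpha_cvg p1 (c _ _) (c _ _) (c _ _) (c _ _)).
Qed.

Let psi0_s : {within J, continuous (psi 0)}.
Proof.
apply/subspace_continuousP => s Js.
have c m n := (subspace_continuousP _ _).1 (@Gcs m n 0 I0) s Js.
exact: (d_alpha_cvg p1 (c _ _) (c _ _) (c _ _) (c _ _)).
Qed.

Let psi_c : {within I `*` J, continuous (fun z : R * R => psi z.1 z.2)}.
Proof.
apply/subspace_continuousP => z IJz.
have c m n := (subspace_continuousP _ _).1 (@Gc m n) z IJz.
exact: (d_alpha_cvg p1 (c _ _) (c _ _) (c _ _) (c _ _)).
Qed.

Let int_compact (f : R -> R) : {within J, continuous f} -> mu.-integrable J (EFin \o f).
Proof. by apply: continuous_compact_integrable; exact: segment_compact. Qed.

(* [psi] is continuous on a compact rectangle, where the parameter is at most eps / 2 in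
   absolute value. *)
Let psi_bounded : exists2 M : R, 0 <= M &
  forall r s, `](- (eps / 2)), (eps / 2)[%classic r -> J s -> `|psi r s| <= M.
Proof.
have e0 := eps0.
have sub : `[- (eps / 2), eps / 2]%classic `*` J `<=` I `*` J.
  move=> -[r s] [/= /[!in_itv]/= /andP[r1 r2] Js]; split => //=.
  by rewrite ?in_itv/=; apply/andP; split; lra.
have := continuous_compact (continuous_subspaceW sub psi_c)
  (compact_setX (@segment_compact _ _ _) (@segment_compact _ _ _)).
move=> /compact_bounded[M [_ /(_ (Num.max 0 (M + 1)))]] H.
exists (Num.max 0 (M + 1)); first by rewrite le_max lexx.
move=> r s Ir Js; apply: H.
  by rewrite lt_max; apply/orP; right; lra.
exists (r, s) => //; split => //=.
exact: subset_itv_oo_cc Ir.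
Qed.

Let phi_integral : is_derive (0 : R) 1 (fun r => \int[mu]_(s in J) phi r s)
  (\int[mu]_(s in J) psi 0 s).
Proof.
have [M M0 HM] := psi_bounded.
have e0 := eps0.
have sub r : `](- (eps / 2)), (eps / 2)[%classic r -> I r.
  by rewrite /= !in_itv/= => /andP[r1 r2]; apply/andP; split; lra.
have I20 : `](- (eps / 2)), (eps / 2)[%classic (0 : R).
  by rewrite /= in_itv/= oppr_lt0 divr_gt0.
have mJ : measurable J by exact: measurable_itv.
have h1 r : `](- (eps / 2)), (eps / 2)[%classic r -> mu.-integrable J (EFin \o phi r).
  by move=> /sub Ir; apply: int_compact; exact: phi_s.
have h2 r s : `](- (eps / 2)), (eps / 2)[%classic r -> J s -> derivable (phi^~ s) r 1.
  by move=> /sub Ir Js; case: (phi_r Ir Js).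
have h3 r s : `](- (eps / 2)), (eps / 2)[%classic r -> J s ->
    `|partial1of2 phi r s| <= cst M s.
  move=> Ir Js; rewrite partial1of2E; case: (phi_r (sub _ Ir) Js) => _ ->.
  exact: HM.
have iM : mu.-integrable J (EFin \o cst M).
  by apply: int_compact; apply: continuous_subspaceT => s; exact: cst_continuous.
have E : \int[mu]_(s in J) psi 0 s = \int[mu]_(s in J) partial1of2 phi 0 s.
  apply: eq_Rintegral => s; rewrite inE => Js.
  by rewrite partial1of2E; case: (phi_r I0 Js) => _ ->.
rewrite E; apply: DeriveDef.
  exact: (@derivable_under_integral R _ _ mu phi J mJ 0 _ _ I20 h1 h2 (cst M) (fun=> M0) iM h3).
rewrite -derive1E.
exact: (@differentiation_under_integral R _ _ mu phi J mJ 0 _ _ I20 h1 h2 (cst M) (fun=> M0) iM h3).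
Qed.

Let psi_split (z0 : G 1 0 0 a = 0) (z1 : G 1 0 0 b = 0) :
  \int[mu]_(s in J) psi 0 s =
  \int[mu]_(s in J) omega_tilde p (G 0 0 0 s) (G 1 0 0 s) (G 0 1 0 s).
Proof.
have bd0 s : G 1 0 0 s = 0 -> bd s = 0.
  move=> E; rewrite /bd /alpha E /= mulr0 subr0.
  have -> : omega (G 0 0 0 s).1 0 = 0 by rewrite -(subrr (0 : V)) omegaBr subrr.
  by rewrite mulr0.
have Ebd : \int[mu]_(s in J) bd' s = 0.
  have nb s : s \in `]a, b[ -> is_derive s 1 bd (bd' s).
    move=> sab; have Js : J s by exact: subset_itv_oo_cc.
    apply: (@slope_within_open _ `]a, b[%classic) => //.
    apply: (slope_within_sub _ (bd_s Js)).
    exact: subset_itv_oo_cc.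
  have cb : {within J, continuous bd} by exact: slope_within_continuous bd_s.
  have [c1 c2 c3] := (continuous_within_itvP _ ab).1 cb.
  rewrite /Rintegral (@continuous_FTC2 _ _ bd a b ab bd'_s).
  - by rewrite !bd0//= subrr.
  - by split => // s sab; case: (nb s sab).
  - by move=> s sab; rewrite derive1E; case: (nb s sab).
have E s : omega_tilde p (G 0 0 0 s) (G 1 0 0 s) (G 0 1 0 s) = psi 0 s - bd' s.
  by rewrite /psi /bd' (d_alpha_omega_tilde p1 _ (G 1 0 0 s)) addrAC subrr add0r.
under [RHS]eq_Rintegral do rewrite E.
rewrite RintegralB//; [by rewrite Ebd subr0|exact: int_compact|exact: int_compact].
Qed.

(** The first variation formula, for families whose endpoints are stationary at the
    parameter 0. *)
Theorem action_variation (Gamma : R -> R -> W) :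
  (forall r s, I r -> J s -> G 0 0 r s = Gamma r s) ->
  G 1 0 0 a = 0 -> G 1 0 0 b = 0 ->
  is_derive (0 : R) (1 : R) (fun r => action p a b (Gamma r))
    (\int[mu]_(s in J) omega_tilde p (G 0 0 0 s) (G 1 0 0 s) (G 0 1 0 s)).
Proof.
move=> GG za zb; rewrite -psi_split//.
apply: near_eq_is_derive phi_integral.
have nI : \forall r \near (0 : R), I r.
  have oI : open I by exact: open_itvoo.
  by move: oI; rewrite openE; apply; exact: I0.
apply: filterS nI => r Ir; apply: eq_Rintegral => s; rewrite inE => Js.
rewrite /phi -(GG r s Ir Js) (@derivative_withinE _ _ a b s (Gamma r) (G 0 1 r s) ab Js)//.
apply: slope_within_ext (Gs Ir Js) => // y Jy; exact: GG.
Qed.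

End Variation.

(** * Critical curves *)

Section LinearVariation.
Variable R : realType.
Local Notation W := (H1 R * R)%type.

Variables (eta : R -> R) (w : W) (g : nat -> R -> W) (a b : R).
Hypothesis seta : smooth_fun eta.
Local Notation J := (`[a, b]%classic : set R).
Hypothesis gJ : forall n s, J s -> slope_within J (g n) s --> g n.+1 s.

(** The partial derivatives of the family [g 0 s + (r * eta s) *: w], where [g n] is
    the [n]-th derivative of the curve [g 0]. *)
Definition linear_variation (m n : nat) (r s : R) : W :=
  match m with
  | 0 => g n s + (r * derive1n n eta s) *: w
  | 1 => derive1n n eta s *: w
  | _ => 0
  end.

Let eta_slope n (s : R) : slope_within J (derive1n n eta) s --> derive1n n.+1 eta s.
Proof.
have d : derivable (derive1n n eta) s 1 by exact: seta.
have : h^-1 *: (derive1n n eta (s + h) - derive1n n eta s) @[h --> 0^'] --> derive1n n.+1 eta s.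
  have /cvg_ex[l hl] := d; have e := cvg_lim (@norm_hausdorff _ _) hl.
  have -> : derive1n n.+1 eta s = l.
    by rewrite -e /derive1n iterS derive1E.
  move: hl; under eq_fun do rewrite scaler1.
  by apply: cvg_trans; apply: near_eq_cvg; apply: nearW => h; rewrite /= (addrC h).
by move=> H; exact: cvg_within_filter H.
Qed.

Lemma slopeZ (f : R -> R) (s l : R) (K : set R) (v : W) :
  slope_within K f s --> l -> slope_within K (fun t => f t *: v) s --> l *: v.
Proof.
move=> fl; have : (h^-1 *: (f (s + h) - f s)) *: v @[h --> incr K s] --> l *: v.
  by apply: cvgZ; [exact: fl|exact: cvg_cst].
apply: cvg_trans; apply: near_eq_cvg; apply: nearW => h.
by rewrite -scalerBl scalerA.
Qed.

Lemma slope_cst (K : set R) (s : R) (v : W) : slope_within K (fun=> v) s --> (0 : W).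
Proof.
have : (fun=> 0 : W) @ incr K s --> (0 : W) by exact: cvg_cst.
by apply: cvg_trans; apply: near_eq_cvg; apply: nearW => h; rewrite subrr scaler0.
Qed.

Lemma slopeD (K : set R) (s : R) (f h : R -> W) (l k : W) :
  slope_within K f s --> l -> slope_within K h s --> k ->
  slope_within K (fun t => f t + h t) s --> l + k.
Proof.
move=> fl hk.
have : h0^-1 *: (f (s + h0) - f s) + h0^-1 *: (h (s + h0) - h s) @[h0 --> incr K s] --> l + k.
  by apply: cvgD; [exact: fl|exact: hk].
apply: cvg_trans; apply: near_eq_cvg; apply: nearW => e.
by rewrite /= -scalerDr; congr (_ *: _); rewrite opprD addrACA.
Qed.

Lemma linear_variation_r (K : set R) m n r s :
  slope_within K (fun r' => linear_variation m n r' s) r --> linear_variation m.+1 n r s.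
Proof.
case: m => [|[|m]] /=; [|exact: slope_cst|exact: slope_cst].
rewrite -[X in _ --> X]add0r; apply: slopeD; first exact: slope_cst.
apply: slopeZ.
have : (fun=> derive1n n eta s) @ incr K r --> derive1n n eta s by exact: cvg_cst.
apply: cvg_trans; apply: near_eq_cvg.
have := near_incr_neq0 K r; apply: filterS => h h0.
by rewrite -mulrBl addrAC subrr add0r /GRing.scale/= mulrA mulVf// mul1r.
Qed.

Lemma linear_variation_s m n r s : J s ->
  slope_within J (linear_variation m n r) s --> linear_variation m n.+1 r s.
Proof.
move=> Js; case: m => [|[|m]] /=; last exact: slope_cst.
  apply: slopeD; first exact: gJ.
  apply: slopeZ.
  have : r * (h^-1 *: (derive1n n eta (s + h) - derive1n n eta s)) @[h --> incr J s]
      --> r * derive1n n.+1 eta s.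
    by apply: cvgM; [exact: cvg_cst|exact: eta_slope].
  apply: cvg_trans; apply: near_eq_cvg; apply: nearW => h.
  by rewrite /GRing.scale/=; ring.
by apply: slopeZ; exact: eta_slope.
Qed.

Lemma linear_variation_continuous (K : set R) m n :
  {within K `*` J, continuous (fun z : R * R => linear_variation m n z.1 z.2)}.
Proof.
have ce : continuous (derive1n n eta).
  by move=> x; apply/differentiable_continuous/derivable1_diffP; exact: seta.
have cg : {within J, continuous (g n)} by apply: slope_within_continuous => s Js; exact: gJ.
have sJ (z : R * R) : (K `*` J) z -> snd @ within (K `*` J) (nbhs z) --> within J (nbhs z.2).
  move=> KJz A [e /= e0 eA]; exists (ball z.1 e, ball z.2 e) => /=.
    by split; exact: nbhsx_ballx.
  by move=> -[r s] [/= br bs] [Kr Js]; exact: eA.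
have cs (z : R * R) : derive1n n eta z.2 @[z --> within (K `*` J) (nbhs z)] --> derive1n n eta z.2.
  apply: cvg_within_filter.
  have c2 : {for z, continuous (@snd R R)} by exact: cvg_snd.
  exact: (continuous_comp c2 (ce z.2)).
apply/subspace_continuousP => z KJz.
case: m => [|[|m]] /=; last exact: cvg_cst.
  apply: cvgD.
    apply: (@cvg_comp _ _ _ snd (g n) _ _ _ (sJ z KJz)).
    exact: ((subspace_continuousP _ _).1 cg z.2 KJz.2).
  apply: cvgZ; last exact: cvg_cst.
  apply: cvgM; last exact: cs.
  by apply: cvg_within_filter; exact: cvg_fst.
by apply: cvgZ; [exact: cs|exact: cvg_cst].
Qed.

End LinearVariation.

Section Criticality.
Variables (R : realType) (p : R).
Hypothesis p1 : 1 < p.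
Local Notation mu := (@lebesgue_measure R).
Local Notation V := (H1 R).
Local Notation W := (V * R)%type.

Lemma omega_tildeC (z w w' : W) : omega_tilde p z w w' = - omega_tilde p z w' w.
Proof.
rewrite /omega_tilde (omegaC w.1).
move: (omega _ _) (d_hamiltonian p z.1 w.1) (d_hamiltonian p z.1 w'.1) => o h h'.
by ring.
Qed.

Lemma omega_tildeZl (k : R) (z w w' : W) :
  omega_tilde p z (k *: w) w' = k * omega_tilde p z w w'.
Proof.
rewrite /omega_tilde !(d_hamiltonianE p1) [(k *: w).1]/(k *: w.1) omegaZl (gradZr p1).
have -> : (k *: w).2 = k * w.2 by [].
move: (omega _ _) (grad p z.1 w.1) (grad p z.1 w'.1) => o h h'.
by ring.
Qed.

Lemma omega_tilde_cvg (T : Type) (F : set_system T) (FF : Filter F) (f g : T -> W) (w z z' : W) :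
  f @ F --> z -> g @ F --> z' ->
  omega_tilde p (f t) w (g t) @[t --> F] --> omega_tilde p z w z'.
Proof.
move=> fz gz; rewrite /omega_tilde.
under eq_fun do rewrite !d_hamiltonianE//.
rewrite !d_hamiltonianE//.
have f1 := cvg_pair1 fz; have g1 := cvg_pair1 gz; have g2 := cvg_pair2 gz.
apply: cvgD; last first.
  by apply: cvgM; [exact: grad_cvg|exact: cvg_cst].
apply: cvgB; first by apply: omega_cvg; [exact: cvg_cst|exact: g1].
by apply: cvgM; [apply: grad_cvg => //; exact: cvg_cst|exact: g2].
Qed.

Lemma critical_of_ker (a b : R) (gamma : R -> W) : a < b ->
  (forall s : R, `[a, b]%classic s ->
     ker_omega_tilde p (gamma s) (derivative_within `[a, b]%classic gamma s)) ->
  critical p a b gamma.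
Proof.
move=> ab hk eps Gamma eps0 [G [G0 Gc Gr Gs]] Gg [K [cK KI] HK].
have I0 : `]- eps, eps[%classic (0 : R) by rewrite /= in_itv/= oppr_lt0 eps0.
have Gend s : `[a, b]%classic s -> ~ K s -> G 1 0 0 s = 0.
  move=> Js nK.
  (* Limits of slopes are unique on a closed interval of parameters around 0. *)
  have sub : `[- (eps / 2), eps / 2]%classic `<=` (`]- eps, eps[%classic : set R).
    by move=> r /=; rewrite !in_itv/= => /andP[r1 r2]; apply/andP; split; lra.
  have J0 : `[- (eps / 2), eps / 2]%classic (0 : R).
    by rewrite /= in_itv/= oppr_le0 divr_ge0// ltW.
  have L := slope_within_sub sub (Gr 0%N 0%N 0 s I0 Js).
  have pf := @incr_proper _ (- (eps / 2)) (eps / 2) 0 ltac:(lra) J0.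
  have L0 : slope_within `[- (eps / 2), eps / 2]%classic (fun r => G 0 0 r s) 0 --> (0 : W).
    apply: slope_within_ext (slope_cst _ _ (gamma s)) => // r /sub Ir.
    by rewrite G0// HK// inE.
  exact: (cvg_unique (@norm_hausdorff _ _) L L0).
have as_ : `[a, b]%classic a by rewrite /= in_itv/= lexx ltW.
have bs_ : `[a, b]%classic b by rewrite /= in_itv/= lexx ltW.
have na : ~ K a by move=> /KI /=; rewrite in_itv/= ltxx.
have nb : ~ K b by move=> /KI /=; rewrite in_itv/= ltxx andbF.
have := @action_variation R p p1 a b eps ab eps0 G Gc Gr Gs Gamma G0 (Gend _ as_ na) (Gend _ bs_ nb).
rewrite (_ : Rintegral _ _ _ = 0)//.
rewrite (@eq_Rintegral _ _ _ _ _ (cst 0)); first by rewrite /Rintegral integral0.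
move=> s; rewrite inE => Js /=.
have Eg y : `[a, b]%classic y -> G 0 0 0 y = gamma y.
  by move=> Jy; rewrite G0// Gg// inE.
have Ed : derivative_within `[a, b]%classic gamma s = G 0 1 0 s.
  apply: derivative_withinE => //.
  by apply: slope_within_ext (Gs 0%N 0%N 0 s I0 Js).
by rewrite omega_tildeC Eg// -Ed hk// oppr0.
Qed.

(** Near any point of [a, b], endpoints included, there is an interval contained
    in the interior of [a, b]. *)
Lemma interior_bump (a b s0 dl : R) : a < b -> a <= s0 <= b -> 0 < dl ->
  exists x d : R, [/\ 0 < d, d <= 1, a < x - d, x + d < b &
    forall t, x - d <= t <= x + d -> `|t - s0| < dl].
Proof.
move=> ab /andP[as0 s0b] dl0.
pose rho := Num.min (Num.min dl 1) (b - a) / 4.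
have r1 : rho <= dl / 4 by rewrite ler_pM2r// !ge_min lexx.
have r2 : rho <= 1 / 4 by rewrite ler_pM2r// !ge_min lexx orbT.
have r3 : rho <= (b - a) / 4 by rewrite ler_pM2r// !ge_min lexx orbT.
have r0 : 0 < rho by rewrite divr_gt0// !lt_min dl0 ltr01 subr_gt0.
have [h|h] := lerP s0 ((a + b) / 2).
  exists (s0 + rho), (rho / 2); split; try lra.
  by move=> t /andP[t1 t2]; rewrite ltr_norml; apply/andP; split; lra.
exists (s0 - rho), (rho / 2); split; try lra.
by move=> t /andP[t1 t2]; rewrite ltr_norml; apply/andP; split; lra.
Qed.

Lemma ker_of_critical (a b : R) (gamma : R -> W) : a < b ->
  smooth_on `[a, b]%classic gamma -> critical p a b gamma ->
  forall s : R, `[a, b]%classic s ->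
     ker_omega_tilde p (gamma s) (derivative_within `[a, b]%classic gamma s).
Proof.
move=> ab [g [g0 gs]] crit s0 Js0 w /=.
have gsJ n s : `[a, b]%classic s -> slope_within `[a, b]%classic (g n) s --> g n.+1 s.
  by move=> Js; exact: gs.
rewrite -g0// (_ : derivative_within _ _ _ = g 1%N s0); last first.
  by apply: derivative_withinE => //; apply: slope_within_ext (gsJ 0%N s0 Js0).
rewrite omega_tildeC; apply/eqP; rewrite oppr_eq0; apply/eqP.
(* Testing criticality on the variations [eta w], for all bumps [eta], shows that the
   continuous function [c] vanishes. *)
pose c s := omega_tilde p (g 0%N s) w (g 1%N s).
rewrite -[LHS]/(c s0).
have gc n : {within `[a, b]%classic, continuous (g n)}.
  by apply: slope_within_continuous => s Js; exact: gsJ.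
have cc : {within `[a, b]%classic, continuous c}.
  apply/subspace_continuousP => s Js.
  apply: omega_tilde_cvg.
    exact: ((subspace_continuousP _ _).1 (gc 0%N) s Js).
  exact: ((subspace_continuousP _ _).1 (gc 1%N) s Js).
apply/eqP/negPn/negP => c0.
(* [e] is positive near [s0], whatever the sign of [c s0]. *)
pose e s := c s0 * c s.
have e0 : 0 < e s0 by rewrite /e -expr2 exprn_even_gt0.
have ce : {within `[a, b]%classic, continuous e}.
  apply/subspace_continuousP => s Js; apply: cvgM; first exact: cvg_cst.
  exact: ((subspace_continuousP _ _).1 cc s Js).
have e2 : e s0 / 2 < e s0 by move: (e s0) e0 => y; lra.
have [dl /= dl0 Hdl] : \forall t \near within `[a, b]%classic (nbhs s0), e s0 / 2 < e t.
  exact: (cvgr_gt _ ((subspace_continuousP _ _).1 ce s0 Js0) _ e2).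
have s0ab : a <= s0 <= b by move: Js0; rewrite /= in_itv.
have [x [d [d0 d1 xa xb Hx]]] := interior_bump ab s0ab dl0.
pose eta := bump_at x d.
have eta_out t : ~~ (x - d <= t <= x + d) -> eta t = 0.
  move=> h; apply: bump_at_out => //.
  by move: h; rewrite negb_and -!ltNge ler_normr => /orP[] h; apply/orP; [right|left]; lra.
have seta : smooth_fun eta by exact: smooth_bump_at.
pose G := linear_variation eta w g.
have Gs m n r s : `]-1, 1[%classic r -> `[a, b]%classic s ->
    slope_within `[a, b]%classic (G m n r) s --> G m n.+1 r s.
  by move=> _ Js; exact: linear_variation_s.
have Gr m n r s : `]-1, 1[%classic r -> `[a, b]%classic s ->
    slope_within `]-1, 1[%classic (fun r' => G m n r' s) r --> G m.+1 n r s.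
  by move=> _ _; exact: linear_variation_r.
have Gc m n : {within `]-1, 1[%classic `*` `[a, b]%classic,
    continuous (fun z : R * R => G m n z.1 z.2)}.
  exact: linear_variation_continuous.
have Ga : G 1%N 0%N 0 a = 0.
  by rewrite /G /= eta_out ?scale0r// negb_and -!ltNge xa.
have Gb : G 1%N 0%N 0 b = 0.
  by rewrite /G /= eta_out ?scale0r// negb_and -!ltNge xb orbT.
have D1 := @action_variation R p p1 a b 1 ab ltr01 G Gc Gr Gs (G 0%N 0%N) (fun _ _ _ _ => erefl) Ga Gb.
have D2 : is_derive (0 : R) (1 : R) (fun r => action p a b (G 0%N 0%N r)) 0.
  apply: (crit 1 (G 0%N 0%N)) => //.
  - by exists G; split.
  - by move=> s; rewrite inE => Js; rewrite /G /= mul0r scale0r addr0 g0.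
  - exists `[x - d, x + d]%classic.
      split; first exact: segment_compact.
      by move=> t /=; rewrite !in_itv/= => /andP[t1 t2]; apply/andP; split; lra.
    move=> r s _; rewrite inE => Js nK.
    rewrite /G /= eta_out ?mulr0 ?scale0r ?addr0 ?g0//.
    by apply/negP => h; apply: nK; rewrite /= in_itv.
have E0 : \int[mu]_(s in `[a, b]) (eta s * c s) = 0.
  case: D1 => _ V1; case: D2 => _ V2.
  rewrite -V2 V1; apply: eq_Rintegral => s _.
  by rewrite /G /= !mul0r !scale0r !addr0 omega_tildeZl.
have ceta : continuous eta by exact: bump_at_continuous.
have ieta : mu.-integrable `[a, b] (EFin \o eta).
  apply: continuous_compact_integrable; first exact: segment_compact.
  exact: continuous_subspaceT.
have iec : mu.-integrable `[a, b] (EFin \o (fun s => eta s * c s)).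
  apply: continuous_compact_integrable; first exact: segment_compact.
  apply/subspace_continuousP => s Js; apply: cvgM.
    by apply: cvg_within_filter; exact: ceta.
  exact: ((subspace_continuousP _ _).1 cc s Js).
have mJ : measurable `[a, b]%classic by exact: measurable_itv.
have E1 : \int[mu]_(s in `[a, b]) eta s = bump_prim 1.
  rewrite -(bump_at_integral x d0 d1) Rintegral_mkcond; apply: eq_Rintegral => t _.
  rewrite patchE; case: ifPn => // /negP h; rewrite -/(eta t) eta_out//.
  apply/negP => /andP[t1 t2]; apply: h; rewrite inE /= in_itv/=; apply/andP; split; lra.
(* On the support of [eta], [e] is at least half its value at [s0]. *)
have : \int[mu]_(s in `[a, b]) (e s0 / 2 * eta s) <= \int[mu]_(s in `[a, b]) (c s0 * (eta s * c s)).
  apply: le_Rintegral => //.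
  - exact: integrableZ_EFin.
  - exact: integrableZ_EFin.
  - move=> s Js.
    have eta0 : 0 <= eta s by exact: bump_at_ge0.
    have [h|/negPf h] := boolP (x - d <= s <= x + d); last first.
      by rewrite eta_out ?h// mul0r !mulr0.
    have := Hdl s; rewrite /ball_/= distrC => /(_ (Hx s h) Js).
    by rewrite [leRHS]mulrCA [leLHS]mulrC => /ltW h'; exact: ler_wpM2l.
have -> : \int[mu]_(s in `[a, b]) (e s0 / 2 * eta s) = e s0 / 2 * bump_prim 1.
  by rewrite -E1; exact: RintegralZl.
have -> : \int[mu]_(s in `[a, b]) (c s0 * (eta s * c s)) = 0.
  by rewrite -[RHS](mulr0 (c s0)) -E0; exact: RintegralZl.
rewrite leNgt => /negP; apply.
by rewrite mulr_gt0 ?bump_prim_gt0// divr_gt0.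
Qed.

End Criticality.

End CriticalCurves.

Theorem proposition3 (R : realType) (p : R) (a b : R) (gamma : R -> H1 R * R)
    (hp : 1 < p) (hab : a < b) (hgamma : smooth_on `[a, b]%classic gamma) :
  critical p a b gamma <->
  (forall s : R, s \in `[a, b] ->
     ker_omega_tilde p (gamma s) (derivative_within `[a, b]%classic gamma s)).
Proof.
split=> [crit s Js|hk].
  by apply: (CriticalCurves.ker_of_critical hp hab hgamma crit); move: Js; rewrite ?inE.
by apply: CriticalCurves.critical_of_ker => // s Js; apply: hk; rewrite ?inE.
Qed.
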